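(* Let $f:\mathcal X\to[0,1]$, $\mathcal X\subset[0,1]$, be a topologically transitive, piecewise expanding Markov map with repeller $\Lambda$, and let $\mu$ be an ergodic $f$-invariant probability measure supported on $\Lambda$. Suppose $\overline{\dim}_M(\mu)=\infty$ but $0<\underline{\dim}_M^s(\mu)$ and $\overline{\dim}_M^s(\mu)<\infty$ (both stretched Minkowski dimensions lie in $(0,\infty)$). Then for $\mu$-a.e. $x\in\Lambda$, $$\liminf_{r\to0}\frac{\log\log\tau_r(x)}{-\log r}\ge\underline{\dim}_M^s(\mu),\qquad \limsup_{r\to0}\frac{\log\log\tau_r(x)}{-\log r}\ge\overline{\dim}_M^s(\mu).$$ If moreover $(f,\mu)$ is exponentially $\psi$-mixing, then for $\mu$-a.e. $x\in\Lambda$, $$\liminf_{r\to0}\frac{\log\log\tau_r(x)}{-\log r}=\underline{\dim}_M^s(\mu),\qquad \limsup_{r\to0}\frac{\log\log\tau_r(x)}{-\log r}=\overline{\dim}_M^s(\mu).$$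
   Context: Setting. Let $\mathcal A$ be a finite or countable index set and $\mathcal P=\{P_a\}_{a\in\mathcal A}$ a collection of subintervals of $[0,1]$ with disjoint interiors covering $\mathcal X\subset[0,1]$. A map $f:\mathcal X\to[0,1]$ is a piecewise expanding Markov map if (1) for every $a\in\mathcal A$, $f_a:=f|_{P_a}$ is continuous, injective, and $f(P_a)$ is a union of elements of $\mathcal P$; (2) there is a uniform constant $\gamma>1$ with $|Df_a|\ge\gamma$ for all $a\in\mathcal A$. The repeller is $\Lambda:=\{x\in\mathcal X: f^k(x)\in\bigcup_{a\in\mathcal A}P_a \text{ for all } k\ge0\}$. Let $M$ be the $\mathcal A\times\mathcal A$ matrix with $M_{ab}=1$ if $f(P_a)\cap P_b\ne\emptyset$ and $M_{ab}=0$ otherwise; $f$ is topologically transitive if for all $a,b\in\mathcal A$ there is $k$ with $(M^k)_{ab}>0$. Symbolic coding. $\Sigma:=\{(x_0,x_1,\dots)\in\mathcal A^{\mathbb N_0}: M_{x_k,x_{k+1}}=1\ \forall k\ge0\}$ with left shift $\sigma$; the projection $\pi:\Sigma\to\Lambda$ is given by $x=\pi(x_0,x_1,\dots)$ iff $x\in\bigcap_{i\ge0}f^{-i}P_{x_i}$, so $f\circ\pi=\pi\circ\sigma$. The symbolic measure $\tilde\mu$ corresponding to $\mu$ satisfies $\mu=\pi_*\tilde\mu$. $\Sigma_n$ is the set of admissible words of length $n$, $\Sigma^*=\bigcup_{l\ge1}\Sigma_l$, and for $\mathbf i=(i_0,\dots,i_{n-1})\in\Sigma_n$, $[\mathbf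 i]:=\{y\in\Sigma: y_j=i_j,\ 0\le j\le n-1\}$. Exponential $\psi$-mixing. $(f,\mu)$ is exponentially $\psi$-mixing if there are $C_1,\rho>0$ and a monotone decreasing function $\psi$ with $\psi(k)\le C_1e^{-\rho k}$ for all $k\in\mathbb N$ such that for all $n,k\in\mathbb N$, $\mathbf i\in\Sigma_n$, $\mathbf j\in\Sigma^*$, $$\left|\frac{\tilde\mu([\mathbf i]\cap\sigma^{-(n+k)}[\mathbf j])}{\tilde\mu[\mathbf i]\,\tilde\mu[\mathbf j]}-1\right|\le\psi(k).$$ Cover time. For $x\in\Lambda$ and $r>0$, $\tau_r(x):=\inf\{k:\ \forall y\in\Lambda\ \exists\, j\le k \text{ with } d(f^j(x),y)<r\}$ (here $j,k$ are non-negative integers and $d(x,y)=|x-y|$). Dimensions. $M_\mu(r):=\min_{x\in\mathrm{supp}(\mu)}\mu(B(x,r))$; the upper Minkowski dimension is $\overline{\dim}_M(\mu):=\limsup_{r\to0}\frac{\log M_\mu(r)}{\log r}$; the upper and lower stretched Minkowski dimensions are $\overline{\dim}_M^s(\mu):=\limsup_{r\to0}\frac{\log|\log M_\mu(r)|}{-\log r}$ and $\underline{\dim}_M^s(\mu):=\liminf_{r\to0}\frac{\log|\log M_\mu(r)|}{-\log r}$. *)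

(* Defs.v *)
From mathcomp Require Import all_boot all_order all_algebra.
From mathcomp Require Import all_classical all_reals all_analysis.

Set Implicit Arguments.
Unset Strict Implicit.
Unset Printing Implicit Defensive.

Import Order.TTheory GRing.Theory Num.Theory.
Import numFieldNormedType.Exports.

Local Open Scope classical_set_scope.
Local Open Scope ring_scope.

Section MarkovMaps.
Variables (R : realType) (A : pointedType).
Variables (P : A -> set R) (X : set R) (f : R -> R).

(* A map X -> [0, 1] is represented by a total f : R -> R, whose
   values outside X never matter for the orbits of points of the repeller.  The derivative bound is asked in the
   interior of each interval only, where f coincides with its branch f_a. *)
Record piecewise_expanding_markov : Prop := PiecewiseExpandingMarkov {
  markov_domain01 : X `<=` `[0, 1] ;
  markov_range01 : forall x, X x -> 0 <= f x <= 1 ;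
  markov_interval : forall a, is_interval (P a) ;
  markov_nondegenerate : forall a, (P a)° !=set0 ;
  markov_disjoint : trivIset [set: A] (fun a => (P a)°) ;
  markov_sub : forall a, P a `<=` X ;
  markov_cover : X `<=` \bigcup_a P a ;
  markov_continuous : forall a, {within P a, continuous f} ;
  markov_injective : forall a, {in P a &, injective f} ;
  markov_image : forall a, exists B : set A, f @` P a = \bigcup_(b in B) P b ;
  markov_expanding : exists2 gamma : R, 1 < gamma &
    forall a (x : R), (P a)° x -> derivable f x 1 /\ gamma <= `|derive1 f x|
}.

Definition repeller : set R :=
  [set x | X x /\ forall k, (\bigcup_a P a) (iter k f x)].

Definition transition (a b : A) : \bar R :=
  (`[< f @` P a `&` P b !=set0 >]%:R)%:E.

(* The entries of the powers of the possibly infinite matrix [transition] are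
   sums of nonnegative terms, with values in [0, +oo]. *)
Fixpoint transition_pow (k : nat) (a c : A) : \bar R :=
  if k is k'.+1
  then (\esum_(b in [set: A]) (transition a b * transition_pow k' b c))%E
  else ((a == c)%:R)%:E.

Definition topologically_transitive : Prop :=
  forall a b, exists2 k, (0 < k)%N & (0 < transition_pow k a b)%E.

Definition cover_time (r x : R) : \bar R :=
  ereal_inf [set (k%:R)%:E | k in [set k : nat |
    forall y, repeller y -> exists2 j, (j <= k)%N & `|iter j f x - y| < r]].

Definition loglog_cover_rate (x r : R) : \bar R :=
  (lne (lne (cover_time r x)) / (- ln r)%:E)%E.

Definition invariant_measure (mu : set (measurableTypeR R) -> \bar R) : Prop :=
  forall B : set (measurableTypeR R), measurable B ->
    mu (repeller `&` f @^-1` B) = mu B.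

Definition ergodic_measure (mu : set (measurableTypeR R) -> \bar R) : Prop :=
  forall B : set (measurableTypeR R), measurable B -> B `<=` repeller ->
    repeller `&` f @^-1` B = B -> mu B = 0%E \/ mu B = 1%E.

Definition shift_space : set (nat -> A) :=
  [set s | forall k, transition (s k) (s k.+1) = 1%E].

Definition left_shift (s : nat -> A) : nat -> A := fun k => s k.+1.

Definition admissible (w : seq A) : bool :=
  (w != [::]) && sorted (fun a b => transition a b == 1%E) w.

Definition cylinder (w : seq A) : set (nat -> A) :=
  [set s | shift_space s /\ mkseq s (size w) = w].

Definition coded_points (s : nat -> A) : set R :=
  [set x | forall i, P (s i) (iter i f x)].

(* The projection is only partially defined: an admissible sequence codes at
   most one point by expansion, but possibly none when the intervals are not
   closed; it is then given the value 0. *)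
Definition coding_projection (s : nat -> A) : R := xget 0 (coded_points s).

Definition coordinate_sets : set (set (nat -> A)) :=
  [set C | exists n a, C = [set s | s n = a]].

(* As A is countable, this carries the product of the discrete sigma-algebras. *)
Definition sequence_space := g_sigma_algebraType coordinate_sets.

Definition symbolic_measure (mu : probability (measurableTypeR R) R)
    (nu : probability sequence_space R) : Prop :=
  [/\ {ae nu, forall s, shift_space s /\ coded_points s !=set0},
      measurable_fun [set: sequence_space]
        (coding_projection : sequence_space -> measurableTypeR R) &
      forall B : set (measurableTypeR R), measurable B ->
        mu B = pushforward nu
                 (coding_projection : sequence_space -> measurableTypeR R) B].

(* The quotient presupposes that admissible cylinders have positive measure;
   with x / 0 = 0 this is enforced, as the left-hand side would otherwise be 1
   for every k, whereas psi k tends to 0. *)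
Definition exponentially_psi_mixing
    (mu : probability (measurableTypeR R) R) : Prop :=
  exists2 nu : probability sequence_space R, symbolic_measure mu nu &
  exists (C1 rho : R) (psi : nat -> R),
  [/\ 0 < C1, 0 < rho, nonincreasing_seq psi,
      forall k, (0 < k)%N -> psi k <= C1 * expR (- rho * k%:R) &
      forall (v w : seq A) (k : nat),
        admissible v -> admissible w -> (0 < k)%N ->
        `| fine (nu (cylinder v `&` iter (size v + k)%N left_shift @^-1` cylinder w))
           / (fine (nu (cylinder v)) * fine (nu (cylinder w))) - 1 | <= psi k].

End MarkovMaps.

Section Dimensions.
Variables (R : realType) (mu : set (measurableTypeR R) -> \bar R).

Definition measure_support : set R :=
  [set x | forall U : set R, open U -> U x -> (0 < mu U)%E].

(* Balls are open, so x |-> mu (ball x r) is lower semicontinuous and its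
   infimum over a nonempty compact support is attained. *)
Definition min_ball_measure (r : R) : \bar R :=
  ereal_inf [set mu (ball x r) | x in measure_support].

Local Open Scope ereal_scope.

Definition upper_minkowski_dim : \bar R :=
  limf_esup (fun r : R => lne (min_ball_measure r) / (ln r)%:E) (0%R : R)^'+.

Definition stretched_ratio (r : R) : \bar R :=
  lne `|lne (min_ball_measure r)| / (- ln r)%:E.

Definition upper_stretched_minkowski_dim : \bar R :=
  limf_esup stretched_ratio (0%R : R)^'+.

Definition lower_stretched_minkowski_dim : \bar R :=
  limf_einf stretched_ratio (0%R : R)^'+.

End Dimensions.

(* Main.v *)
(** Write [M r = exp (- ell r)].  Positivity of the lower stretched dimension
    gives [ell r >= r ^ (-s)] for small [r], so along [r = 2 ^ (-n)] any positive
    power of [M r] is summable, and a factor or exponent lost in estimating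
    the cover time by a power of [1 / M] only adds a constant to its iterated
    logarithm.

    Lower bound: covering at scale [r] forces a visit to a ball of radius [2 r]
    with nearly minimal measure.  By invariance the probability of a visit before
    time [exp (ell (2 r) / 2)] is of order [exp (- ell (2 r) / 2)]; conclude by
    Borel-Cantelli.

    Upper bound: with [m] about [1 / M], split time into blocks of [m] symbols
    separated by gaps of [m] symbols.  Under psi-mixing the visits to a given
    union of [m]-cylinders approximating a ball are nearly independent from block
    to block, so all of [m ^ 2] blocks miss it with probability at most
    [exp (- m / 2)].  Sum over a net of about [1 / r] balls and apply
    Borel-Cantelli again: the cover time is at most about [2 m ^ 3]. *)

Require Import Defs.
From mathcomp Require Import all_boot all_order all_algebra.
From mathcomp Require Import all_classical all_reals all_analysis.
From mathcomp Require Import measurable_realfun zify ring lra.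

Import Order.TTheory GRing.Theory Num.Theory.
Import numFieldNormedType.Exports.

Local Open Scope classical_set_scope.
Local Open Scope ring_scope.

(** * Limits at zero *)

Section RealAnalysis.
Variable R : realType.

Lemma near_right0P (Q : R -> Prop) :
  (\forall r \near (0 : R)^'+, Q r) <->
  exists2 e : R, 0 < e & forall r : R, 0 < r -> r < e -> Q r.
Proof.
split.
  move=> /nbhs_ballP [e /= e0 he]; exists e => // r r0 re; apply: he => //=.
  by rewrite -ball_normE /ball_/= sub0r normrN gtr0_norm.
move=> [e e0 he]; apply/nbhs_ballP; exists e => //= r.
rewrite -ball_normE /ball_/= sub0r normrN => re r0; apply: he => //.
by rewrite gtr0_norm in re.
Qed.

(** Two reals rather than one, so that [limf_dilate_le] has different thresholds for its two
    functions, with a gap to absorb lower-order terms. *)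
Lemma lte_between2 (x y : \bar R) : (x < y)%E ->
  exists c d : R, [/\ (x < c%:E)%E, c < d & (d%:E < y)%E].
Proof.
have hR (a b : R) : a < b -> exists c d : R, [/\ (a%:E < c%:E)%E, c < d & (d%:E < b%:E)%E].
  move=> ab; have [] : [/\ a < a + (b - a) / 3, a + (b - a) / 3 < a + (b - a) / 2
      & a + (b - a) / 2 < b] by split; lra.
  by exists (a + (b - a) / 3), (a + (b - a) / 2); rewrite !lte_fin.
move: x y => [x| |] [y| |] //=.
- by rewrite lte_fin; exact: hR.
- move=> _; have [|c [d [xc cd _]]] := hR x (x + 1); first by lra.
  by exists c, d; rewrite ltry.
- move=> _; have [|c [d [_ cd dy]]] := hR (y - 1) y; first by lra.
  by exists c, d; rewrite ltNyr.
- by move=> _; exists 0, 1; rewrite ltNyr ltry.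
Qed.

Lemma limf_einf_ge_near (F : R -> \bar R) (c : R) :
  (\forall r \near (0 : R)^'+, c%:E <= F r)%E ->
  (c%:E <= limf_einf F (0 : R)^'+)%E.
Proof.
move=> cF; rewrite limf_einfE; apply: le_ereal_sup_tmp.
exists (ereal_inf (F @` [set r | c%:E <= F r]%E)).
  by exists [set r | c%:E <= F r]%E.
by apply: le_ereal_inf_tmp => _ [r /= cr <-].
Qed.

Lemma lt_limf_einf_near (F : R -> \bar R) (c : R) :
  (c%:E < limf_einf F (0 : R)^'+)%E ->
  \forall r \near (0 : R)^'+, (c%:E <= F r)%E.
Proof.
rewrite limf_einfE => /ereal_sup_gt [_ [V nV <-] cV].
apply: filterS nV => r Vr; apply: ltW; apply: lt_le_trans cV _.
by apply: ereal_inf_lbound; exists r.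
Qed.

Lemma limf_esup_le_near (F : R -> \bar R) (c : R) :
  (\forall r \near (0 : R)^'+, F r <= c%:E)%E ->
  (limf_esup F (0 : R)^'+ <= c%:E)%E.
Proof.
move=> Fc; rewrite limf_esupE; apply: ge_ereal_inf.
exists (ereal_sup (F @` [set r | F r <= c%:E]%E)).
  by exists [set r | F r <= c%:E]%E.
by apply: ge_ereal_sup => _ [r /= cr <-].
Qed.

Lemma limf_esup_lt_near (F : R -> \bar R) (c : \bar R) :
  (limf_esup F (0 : R)^'+ < c)%E ->
  \forall r \near (0 : R)^'+, (F r < c)%E.
Proof.
rewrite limf_esupE => /ereal_inf_lt [_ [V nV <-] cV].
apply: filterS nV => r Vr; apply: le_lt_trans cV.
by apply: ereal_sup_ubound; exists r.
Qed.

(** Suppose a limit of [F] were smaller than that of [G], with [c < c'] strictly between. For the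
    lower limits, [G] is eventually at least [c'], which forces [c] on [F]; for the upper limits,
    [F] eventually stays below [c], which keeps [G] below [c']. *)
Lemma limf_dilate_le (F G : R -> \bar R) (a : R) : 0 < a ->
  (forall c c' : R, c < c' ->
     \forall r \near (0 : R)^'+, (c'%:E <= G (a * r)%R -> c%:E <= F r)%E) ->
  (limf_einf G (0 : R)^'+ <= limf_einf F (0 : R)^'+)%E /\
  (limf_esup G (0 : R)^'+ <= limf_esup F (0 : R)^'+)%E.
Proof.
move=> a0 FG; split; rewrite leNgt; apply/negP => /lte_between2[c [c' [Fc cc' Gc]]].
  have /near_right0P[e1 e10 h1] := lt_limf_einf_near _ _ Gc.
  have /near_right0P[e2 e20 h2] := FG _ _ cc'.
  move: Fc; rewrite ltNge => /negP; apply.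
  apply/limf_einf_ge_near/near_right0P; exists (Num.min e2 (e1 / a)).
    by rewrite lt_min e20 divr_gt0.
  move=> r r0; rewrite lt_min => /andP[re2 re1]; apply: h2 => //; apply: h1.
    exact: mulr_gt0.
  by rewrite mulrC -ltr_pdivlMr.
have /near_right0P[e1 e10 h1] := limf_esup_lt_near _ _ Fc.
have /near_right0P[e2 e20 h2] := FG _ _ cc'.
move: Gc; rewrite ltNge => /negP; apply.
apply/limf_esup_le_near/near_right0P; exists (Num.min (a * e2) (a * e1)).
  by rewrite lt_min !mulr_gt0.
move=> r r0; rewrite lt_min => /andP[re2 re1]; rewrite leNgt; apply/negP => cr.
have aK : a * (r / a) = r by rewrite mulrC divfK// gt_eqF.
have : (c%:E <= F (r / a)%R)%E.
  apply: h2; rewrite ?divr_gt0 ?ltr_pdivrMr// 1?mulrC//.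
  by rewrite mulrC aK ltW.
by apply/negP; rewrite -ltNge h1 ?divr_gt0 ?ltr_pdivrMr// 1?mulrC.
Qed.

Lemma sqr_le_expR (y : R) : 0 <= y -> (y / 2) ^+ 2 <= expR y.
Proof.
move=> y0; have -> : expR y = expR (y / 2) ^+ 2.
  by rewrite expr2 -expRD; congr expR; lra.
have := expR_ge1Dx (y / 2) => h.
by rewrite ler_sqr ?nnegrE ?expR_ge0//; lra.
Qed.

Lemma dyadic_scale (r : R) (N : nat) : 0 < r -> r < 2^-1 ^+ N ->
  exists2 n, (N <= n)%N & 2^-1 ^+ n.+1 <= r < 2^-1 ^+ n.
Proof.
move=> r0 rN.
have ex : exists n, 2^-1 ^+ n.+1 <= r.
  have [n _ /(_ n (leqnn _)) h] := near_infty_natSinv_expn_lt (PosNum r0).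
  exists n; move: h; rewrite /= div1r -exprVn exprSr => h.
  have : (0:R) <= 2^-1 ^+ n by rewrite exprn_ge0.
  lra.
have [n nr nmin] := ex_minnP ex.
have Nn : (N <= n)%N.
  rewrite leqNgt; apply/negP => nN; move: rN; rewrite ltNge => /negP; apply.
  apply: le_trans nr; rewrite -(subnK nN) exprD ler_piMl ?exprn_ge0//.
  by rewrite exprn_ile1//; lra.
exists n => //; rewrite nr/=.
move: nmin nr Nn; case: n => [|n] nmin nr Nn.
  by move: Nn rN; rewrite leqn0 => /eqP ->.
by rewrite ltNge; apply/negP => /nmin; rewrite ltnn.
Qed.

End RealAnalysis.

(** * Minimal ball measure and dyadic scales *)

Section BallMeasure.
Variables (R : realType) (mu : probability (measurableTypeR R) R).

Local Notation M := (min_ball_measure mu).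

Lemma min_ball_measure_le (r r' : R) : r <= r' -> (M r <= M r')%E.
Proof.
move=> rr'; apply: le_ereal_inf_tmp => _ [y ysupp <-].
apply: ge_ereal_inf; exists (mu (ball y r)); first by exists y.
apply: le_measure; rewrite ?inE; try exact: measurable_ball.
exact: le_ball.
Qed.

(* If [M r] were [0], or [+oo] (empty support), [stretched_ratio] would be
   [+oo]; if [M r] were [1] it would be [-oo]. *)
Lemma min_ball_measure_exp :
  (0 < lower_stretched_minkowski_dim mu)%E ->
  (upper_stretched_minkowski_dim mu < +oo)%E ->
  exists (r0 s : R) (ell : R -> R), [/\ 0 < r0, r0 <= 1, 0 < s &
    forall r : R, 0 < r -> r < r0 -> [/\ M r = (expR (- ell r))%:E,
      expR (s * - ln r) <= ell r &
      stretched_ratio mu r = (ln (ell r) / - ln r)%:E]].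
Proof.
move=> /lte_between2 [s0 [s [s00 s0s sL]]] Uoo.
have {s00}s_gt0 : 0 < s by apply: lt_trans s0s; rewrite -lte_fin.
have /near_right0P[e1 e10 h1] := lt_limf_einf_near _ _ _ sL.
have /near_right0P[e2 e20 h2] := limf_esup_lt_near _ _ _ Uoo.
exists (Num.min 1 (Num.min e1 e2)), s, (fun r => - ln (fine (M r))).
split=> //; first by rewrite !lt_min ltr01 e10 e20.
  by rewrite ge_min lexx.
move=> r r0; rewrite !lt_min => /and3P[r1 re1 re2].
have d0 : 0 < - ln r by rewrite oppr_gt0 ln_lt0// r0 r1.
have {h1 re1}h1 := h1 _ r0 re1; have {h2 re2}h2 := h2 _ r0 re2.
have lneoo x : `|lne x|%E = +oo%E -> x = M r -> False.
  move=> xoo xM; move: h2; rewrite /stretched_ratio -xM xoo inver gt_eqF//.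
  by rewrite /lne gt0_mulye ?ltxx// lte_fin invr_gt0.
have p0 : (0 < M r)%E.
  by rewrite ltNge; apply/negP => /le0_lneNy Mr; apply: (lneoo _ _ erefl); rewrite Mr.
have Moo : (M r < +oo)%E.
  by rewrite ltey; apply/negP => /eqP Mr; apply: (lneoo _ _ erefl); rewrite Mr.
have M1 : (M r <= 1)%E.
  have [_ [y ysupp <-] _] := ereal_inf_lt Moo.
  apply: ge_ereal_inf; exists (mu (ball y r)); first by exists y.
  by apply: probability_le1; exact: measurable_ball.
move: h1; rewrite /stretched_ratio.
move: p0 Moo M1; case: (M r) => [p| |] //=; rewrite !lte_fin lee_fin => p0 _ p1.
rewrite !(leNgt p 0) p0/= inver gt_eqF// opprK lnK ?posrE// ler0_norm ?ln_le0//.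
have [lp|lp] := leP (- ln p) 0.
  by rewrite mulNyr gtr0_sg ?invr_gt0// mul1e leeNy_eq.
rewrite -EFinM lee_fin ler_pdivlMr// => h; split=> //.
by rewrite -[leRHS]lnK ?posrE// ler_expR.
Qed.

End BallMeasure.

(** * Growth along dyadic scales *)

Section Growth.
Variable R : realType.

Lemma ln_half_pow (n : nat) : - ln (2^-1 ^+ n : R) = n%:R * ln 2.
Proof. by rewrite lnXn ?invr_gt0// lnV ?posrE// mulNrn opprK mulr_natl. Qed.

Lemma ln2_gt0 : 0 < ln 2 :> R.
Proof. by rewrite ln_gt0// ltr1n. Qed.

Lemma half_pow_gt0 n : 0 < 2^-1 ^+ n :> R.
Proof. by rewrite exprn_gt0// invr_gt0. Qed.

Lemma half_pow_le m n : (m <= n)%N -> 2^-1 ^+ n <= 2^-1 ^+ m :> R.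
Proof.
by move=> mn; apply: ler_wiXn2l => //; rewrite ?invr_ge0// invf_le1// ler1n.
Qed.

Lemma half_pow_small (e : R) : 0 < e ->
  exists N, forall n, (N <= n)%N -> 2^-1 ^+ n < e.
Proof.
move=> e0; have [N _ hN] := near_infty_natSinv_expn_lt (PosNum e0).
by exists N => n /hN; rewrite /= div1r exprVn.
Qed.

Lemma nat_large (C : R) : exists N : nat, forall n, (N <= n)%N -> C <= n%:R.
Proof.
exists (Num.truncn `|C|).+1 => n Nn; apply: le_trans (ler_norm C) _.
by apply/ltW; apply: lt_le_trans (truncnS_gt _) _; rewrite ler_nat.
Qed.

(** At [r = 2 ^ (-n)] the lower bound is exponential in [n], hence at least [c * n ^ 2] by
    [sqr_le_expR], and this is at least [C * n] once [n >= C / c]. *)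
Lemma dyadic_superlinear (r0 s : R) (ell : R -> R) (C : R) : 0 < r0 -> 0 < s ->
  (forall r : R, 0 < r -> r < r0 -> expR (s * - ln r) <= ell r) ->
  exists N, forall n, (N <= n)%N ->
    2^-1 ^+ n < r0 /\ C * n%:R <= ell (2^-1 ^+ n).
Proof.
move=> r00 s0 h.
have [N1 hN1] := half_pow_small _ r00.
pose c := (s * ln 2 / 2) ^+ 2.
have c0 : 0 < c by rewrite exprn_gt0// divr_gt0// mulr_gt0// ln2_gt0.
have [N2 hN2] := nat_large (C / c).
exists (maxn N1 N2) => n; rewrite geq_max => /andP[n1 n2]; split; first exact: hN1.
apply: le_trans (h _ (half_pow_gt0 n) (hN1 _ n1)); rewrite ln_half_pow.
apply: le_trans (sqr_le_expR _ _ _); last first.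
  by rewrite mulr_ge0 ?(ltW s0)// mulr_ge0 ?ler0n// ltW// ln2_gt0.
have -> : (s * (n%:R * ln 2) / 2) ^+ 2 = (n%:R * c) * n%:R.
  by rewrite /c; field.
by rewrite ler_wpM2r ?ler0n// -ler_pdivrMr// hN2.
Qed.

End Growth.

(** * Borel-Cantelli for geometrically small events *)

Section BorelCantelli.
Context d (T : measurableType d) (R : realType) (mu : {measure set T -> \bar R}).

(** Borel-Cantelli for the sequence shifted by [N], so that the bound holds from its first term on;
    the exceptional null set is the limit superior. *)
Lemma eventually_notin_of_geometric (E : nat -> set T) (C : R) (N : nat) :
  (forall n, measurable (E n)) ->
  (forall n, (N <= n)%N -> (mu (E n) <= (C * 2^-1 ^+ n)%:E)%E) ->
  {ae mu, forall x, exists N', forall n, (N' <= n)%N -> ~ E n x}.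
Proof.
move=> mE hE.
pose F n := E (n + N)%N.
have F0 : mu (lim_sup_set F) = 0%E.
  apply: lim_sup_set_cvg0; first by move=> k; exact: mE.
  pose G k := (C * 2^-1 ^+ N * 2 / (2 ^ (k + 1))%:R)%:E.
  have FG k : (mu (F k) <= G k)%E.
    apply: le_trans (hE _ (leq_addl _ _)) _.
    rewrite lee_fin exprD addn1 expnS natrM invfM natrX -exprVn.
    by rewrite le_eqVlt; apply/orP; left; apply/eqP; field.
  apply: (@le_lt_trans _ _ (\sum_(k <oo) G k)%E); first exact: lee_nneseries.
  by have /cvg_lim -> := @cvg_geometric_eseries_half R (C * 2^-1 ^+ N * 2) 0;
    rewrite ?ltry.
exists (lim_sup_set F); split => //.
  apply: bigcap_measurable => // n _; apply: bigcup_measurable => k _; exact: mE.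
move=> x /= nx n _; apply: contrapT => hn; apply: nx.
exists (n + N)%N => k nNk Ek; have Nk : (N <= k)%N := leq_trans (leq_addl _ _) nNk.
by apply: hn; exists (k - N)%N; [rewrite /= leq_subRL 1?addnC|rewrite /F subnK].
Qed.

End BorelCantelli.

(** * Expansion and invariance *)

Section Dynamics.
Variables (R : realType) (A : pointedType).
Variables (P : A -> set R) (X : set R) (f : R -> R).
Hypothesis f_markov : piecewise_expanding_markov P X f.

(** The mean value theorem on [[x, y]], whose interior lies in the interior of [P a], where the
    derivative bound holds; the endpoints require continuity only. *)
Lemma branch_expansion : exists2 gamma : R, 1 < gamma &
  forall a (x y : R), P a x -> P a y -> gamma * `|x - y| <= `|f x - f y|.
Proof.
have [gamma g1 hg] := markov_expanding f_markov.
have g0 : 0 < gamma by lra.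
exists gamma => // a x y.
wlog xy : x y / x < y => [hw Px Py|Px Py].
  have [xy|yx|->] := ltgtP x y; first exact: hw.
    by rewrite distrC (distrC (f x)); exact: hw.
  by rewrite !subrr normr0 mulr0.
have Pxy z : x <= z <= y -> P a z by move=> xzy; exact: (markov_interval f_markov Px Py).
have Pint z : z \in `]x, y[%R -> (P a)° z.
  move=> zxy; have : nbhs z [set` `]x, y[%R].
    by apply: open_nbhs_nbhs; split => //=; exact: interval_open.
  apply: filterS => t /=; rewrite in_itv/= => /andP[xt ty].
  by apply: Pxy; rewrite !ltW.
have [||c cxy fE] := @MVT R f (derive1 f) x y xy.
- move=> z /Pint Pz; have [fz _] := hg _ _ Pz.
  by rewrite derive1E; apply/derivableP.
- have sub : `[x, y] `<=` P a by move=> z /=; rewrite in_itv/=; exact: Pxy.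
  exact: (continuous_subspaceW sub (@markov_continuous _ _ _ _ _ f_markov a)).
have [_ gc] := hg _ _ (Pint _ cxy).
by rewrite distrC (distrC (f x)) fE normrM ler_wpM2r.
Qed.

(** A common itinerary expands the distance by [gamma] at each of [m] steps, while the images of
    both points remain in [[0, 1]]. *)
Lemma branch_itinerary_close : exists2 gamma : R, 1 < gamma &
  forall m (s : nat -> A) (x y : R), X x -> X y ->
    (forall i, (i < m)%N -> P (s i) (iter i f x) /\ P (s i) (iter i f y)) ->
    gamma ^+ m * `|x - y| <= 1.
Proof.
have [gamma g1 hg] := branch_expansion.
have g0 : 0 < gamma by lra.
exists gamma => // m s x y Xx Xy hs.
have step n : (n <= m)%N -> gamma ^+ n * `|x - y| <= `|iter n f x - iter n f y|.
  elim: n => [|n IH] nm; first by rewrite mul1r.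
  have [Px Py] := hs n nm.
  rewrite exprS -mulrA; apply: le_trans (hg _ _ _ Px Py).
  by rewrite ler_wpM2l ?(ltW g0)// IH// ltnW.
(* The last iterate lies in no prescribed interval; it is in [[0, 1]] as the image of a point of [X]
   or, when [m = 0], as a point of [X] itself. *)
have orb01 z : X z -> (forall i, (i < m)%N -> P (s i) (iter i f z)) ->
    0 <= iter m f z <= 1.
  case: m {hs step} => [|m] Xz hz.
    by have := markov_domain01 f_markov Xz; rewrite /= in_itv.
  exact/(markov_range01 f_markov)/(markov_sub f_markov (hz m (leqnn _))).
apply: le_trans (step m (leqnn _)) _.
have /andP[x0 x1] := orb01 x Xx (fun i im => (hs i im).1).
have /andP[y0 y1] := orb01 y Xy (fun i im => (hs i im).2).
by rewrite ler_norml; apply/andP; split; lra.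
Qed.

Lemma markov_domainE : X = \bigcup_a P a.
Proof.
apply/seteqP; split; first exact: (markov_cover f_markov).
by move=> x [a _ Pax]; exact: (markov_sub f_markov Pax).
Qed.

Lemma repeller_domain k x : repeller P X f x -> X (iter k f x).
Proof. by case=> _ /(_ k); rewrite -markov_domainE. Qed.

Lemma repeller_iter k x : repeller P X f x -> repeller P X f (iter k f x).
Proof.
move=> Lx; split; first exact: repeller_domain.
by move=> j; rewrite -iterD -markov_domainE; exact: repeller_domain.
Qed.

Hypothesis A_countable : countable [set: A].

(** [f] is controlled only on [X], a countable union of intervals on each of which it is
    continuous. *)
Lemma measurable_domain_preimage (B : set R) :
  measurable B -> measurable (X `&` f @^-1` B).
Proof.
move=> mB; rewrite markov_domainE setI_bigcupl.
apply: countable_bigcupT_measurable => // a.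
have mP : measurable (P a) by apply: is_interval_measurable; exact: (markov_interval f_markov).
have mf : measurable_fun (P a) f.
  apply: subspace_continuous_measurable_fun => //.
  exact: (@markov_continuous _ _ _ _ _ f_markov a).
exact: mf.
Qed.

(** Points whose first [n] iterates stay in [X] form an iterated preimage, measurable by induction;
    the repeller is the intersection of these sets. *)
Lemma measurable_repeller : measurable (repeller P X f).
Proof.
have -> : repeller P X f =
    \bigcap_n iter n (fun B : set R => X `&` f @^-1` B) X.
  have memE n (x : R) : iter n (fun B : set R => X `&` f @^-1` B) X x <->
      forall k, (k <= n)%N -> X (iter k f x).
    elim: n x => [|n IH] x.
      by split=> [Xx [|//] //|/(_ 0%N (leqnn _))].
    rewrite iterS; split.
      move=> [Xx /IH hx] [//|k] kn; rewrite iterSr; exact: hx.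
    move=> hx; split; first exact: (hx 0%N).
    by apply/IH => k kn; rewrite -iterSr; exact: (hx k.+1).
  apply/seteqP; split=> x.
    by move=> Lx n _; apply/memE => k _; exact: repeller_domain.
  move=> hx; have hX k : X (iter k f x) by apply: (memE k x).1 (hx k I) _ _.
  by split=> [|k]; [exact: (hX 0%N)|rewrite -markov_domainE].
apply: bigcap_measurable => // n _.
elim: n => [|n IH] /=; last exact: measurable_domain_preimage.
rewrite markov_domainE; apply: countable_bigcupT_measurable => // a.
by apply: is_interval_measurable; exact: (markov_interval f_markov).
Qed.

Lemma measurable_iter_preimage k (B : set R) :
  measurable B -> measurable (repeller P X f `&` iter k f @^-1` B).
Proof.
have mL := measurable_repeller.
elim: k B => [|k IH] B mB; first exact: measurableI.
rewrite (_ : _ `&` _ = repeller P X f `&`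
    iter k f @^-1` (X `&` f @^-1` B)).
  by apply: IH; exact: measurable_domain_preimage.
apply/seteqP; split=> x /= [Lx Bx]; split=> //; last by case: Bx.
by split=> //; exact: repeller_domain.
Qed.

Variable mu : probability (measurableTypeR R) R.
Hypothesis mu_repeller : mu (repeller P X f) = 1%E.

Lemma invariant_iter k (B : set R) : invariant_measure P X f mu ->
  measurable B -> mu (repeller P X f `&` iter k f @^-1` B) = mu B.
Proof.
move=> mu_inv; elim: k B => [|k IH] B mB.
  have mL := measurable_repeller.
  rewrite setIC; apply/eqP; rewrite eq_le; apply/andP; split.
    by apply: le_measure; rewrite ?inE; [exact: measurableI|exact: mB|exact: subIsetl].
  have -> : mu B = (mu (B `&` repeller P X f) + mu (B `&` ~` repeller P X f))%E.
    rewrite -measureU ?setIUr//; [|exact: measurableI|apply: measurableI => //; exact: measurableC|].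
      by rewrite -setIUr setUv setIT.
    by rewrite setIACA setICr setI0.
  rewrite [X in (_ + X)%E](_ : _ = 0%E) ?adde0//.
  apply/eqP; rewrite eq_le measure_ge0 andbT.
  have <- : mu (~` repeller P X f) = 0%E by rewrite probability_setC// mu_repeller subee.
  apply: le_measure; rewrite ?inE; [|exact: measurableC|exact: subIsetr].
  by apply: measurableI => //; exact: measurableC.
(* One step of invariance is split off. The repeller is inserted in the inner set, which orbits of
   the repeller never leave, to match the induction hypothesis. *)
rewrite (_ : _ `&` _ = repeller P X f `&`
    f @^-1` (repeller P X f `&` iter k f @^-1` B)).
  by rewrite mu_inv ?IH//; exact: measurable_iter_preimage.
apply/seteqP; split=> x /=; rewrite -iterS iterSr.
  by move=> [Lx Bx]; do 2!split=> //; exact: (@repeller_iter 1).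
by move=> [Lx [_ Bx]].
Qed.

(** A ball of positive measure is not contained in the null complement of the repeller. This is for
    support points outside the repeller: a cover time controls only the distance to repeller
    points. *)
Lemma support_ball_repeller (y r : R) : measure_support mu y -> 0 < r ->
  exists2 y', repeller P X f y' & ball y r y'.
Proof.
move=> ysupp r0; apply: contrapT => hy.
have : (0 < mu (ball y r))%E.
  by apply: ysupp; [exact: ball_open|exact: ballxx].
have mb : measurable (ball y r : set (measurableTypeR R)).
  exact: measurable_ball.
apply/negP; rewrite -leNgt.
have <- : mu (~` repeller P X f) = 0%E.
  by rewrite probability_setC ?mu_repeller ?subee//; exact: measurable_repeller.
apply: le_measure; rewrite ?inE//; first by apply: measurableC; exact: measurable_repeller.
by move=> z yz Lz; apply: hy; exists z.
Qed.

End Dynamics.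

(** * Cylinders in the shift space *)

(** Carries the mixing inequality from single cylinders to countable disjoint unions of them. *)
Lemma le_measure_bigcup d (T : measurableType d) (R : realType)
    (mu nu : {measure set T -> \bar R}) (E F : nat -> set T) (c : R) :
  (forall i, measurable (E i)) -> trivIset setT E ->
  (forall i, measurable (F i)) -> trivIset setT F ->
  (forall i, mu (E i) <= c%:E * nu (F i))%E ->
  (mu (\bigcup_i E i) <= c%:E * nu (\bigcup_i F i))%E.
Proof.
move=> mE tE mF tF EF.
rewrite !measure_semi_bigcup//; [|exact: bigcupT_measurable|exact: bigcupT_measurable].
by rewrite -nneseriesZl//; exact: lee_nneseries.
Qed.

Section SymbolicSpace.
Variables (R : realType) (A : pointedType) (P : A -> set R) (f : R -> R).
Hypothesis A_countable : countable [set: A].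

Local Notation S := (shift_space P f).
Local Notation cyl := (cylinder P f).
Local Notation seqs := (sequence_space A).

Lemma iter_left_shift k (s : nat -> A) i : iter k (@left_shift A) s i = s (i + k)%N.
Proof.
elim: k i => [|k IH] i; first by rewrite addn0.
by rewrite iterS /left_shift IH addSnnS.
Qed.

Lemma shift_space_iter k s : S s -> S (iter k (@left_shift A) s).
Proof. by move=> Ss i; rewrite !iter_left_shift addSn; exact: Ss. Qed.

Lemma measurable_coordinate n a : measurable ([set s | s n = a] : set seqs).
Proof. by apply: sub_sigma_algebra; exists n, a. Qed.

Lemma measurable_coordinate_set n (B : set A) : measurable ([set s | B (s n)] : set seqs).
Proof.
rewrite (_ : [set s | B (s n)] = \bigcup_a [set s : seqs | B a /\ s n = a]); last first.
  by apply/seteqP; split=> s /=; [exists (s n)|move=> [a _ [Ba sa]]; rewrite sa].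
apply: countable_bigcupT_measurable => // a; have [Ba|nBa] := pselect (B a).
  rewrite (_ : [set _ | _] = [set s : seqs | s n = a]); first exact: measurable_coordinate.
  by apply/seteqP; split=> s /= => [[]|].
rewrite (_ : [set _ | _] = set0); first exact: measurable0.
by apply/seteqP; split=> s /= => [[]|].
Qed.

Lemma measurable_shift_space : measurable (S : set seqs).
Proof.
rewrite (_ : S = \bigcap_k \bigcup_a
    ([set s : seqs | s k = a] `&` [set s : seqs | transition P f a (s k.+1) = 1%E])).
  apply: bigcap_measurable => // k _; apply: countable_bigcupT_measurable => // a.
  apply: measurableI; first exact: measurable_coordinate.
  exact: (@measurable_coordinate_set k.+1 [set b | transition P f a b = 1%E]).
apply/seteqP; split=> s /=; first by move=> Ss k _; exists (s k) => //; split=> //; exact: Ss.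
by move=> h k; have [a _ /= [-> ]] := h k I.
Qed.

(** Such sets are the unions of [n]-cylinders of the shift space. *)
Definition prefix_determined n (V : set (nat -> A)) : Prop :=
  V `<=` S /\ forall s s' : nat -> A, S s' -> (forall i, (i < n)%N -> s i = s' i) ->
    V s -> V s'.

Lemma eq_mkseqP n (s s' : nat -> A) :
  mkseq s n = mkseq s' n <-> forall i, (i < n)%N -> s i = s' i.
Proof.
split=> [e i im|e].
  by rewrite -(nth_mkseq point s im) -(nth_mkseq point s' im) e.
by apply/eq_in_map => i; rewrite mem_iota add0n => /andP[_]; exact: e.
Qed.

Lemma cylinderE n (s : nat -> A) :
  cyl (mkseq s n) = [set s' | S s' /\ forall i, (i < n)%N -> s i = s' i].
Proof.
apply/seteqP; split=> s' /=; rewrite /cylinder/= size_mkseq.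
  by move=> [Ss' e]; split=> //; apply/eq_mkseqP.
by move=> [Ss' /eq_mkseqP ->].
Qed.

Lemma measurable_cylinder n (s : nat -> A) : measurable (cyl (mkseq s n) : set seqs).
Proof.
rewrite cylinderE (_ : [set _ | _] =
  S `&` \bigcap_(i in [set i | (i < n)%N]) [set s' : seqs | s' i = s i]).
  apply: measurableI; first exact: measurable_shift_space.
  by apply: bigcap_measurableType => i _; exact: measurable_coordinate.
by apply/seteqP; split=> s' /= [Ss' h]; split=> // i im; rewrite h.
Qed.

(** As [A] is countable, words of length [n] are numbered by naturals, and [V] is split according to
    the number of the prefix. Numbers that do not occur give empty pieces. *)
Lemma prefix_determined_partition n (V : set (nat -> A)) : prefix_determined n V ->
  exists F : nat -> set seqs, [/\ forall i, measurable (F i), trivIset setT F,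
    \bigcup_i F i = V &
    forall i, F i = set0 \/ exists2 s, V s & F i = cyl (mkseq s n)].
Proof.
move=> [VS Vn]; have /countable_injP[e einj] := A_countable.
pose code (s : nat -> A) : nat := pickle (map e (mkseq s n)).
have codeP s s' : code s = code s' <-> forall i, (i < n)%N -> s i = s' i.
  rewrite -eq_mkseqP; split=> [|e0]; last by rewrite /code e0.
  move=> /(pcan_inj pickleK); apply: inj_map => a b; apply: einj; exact: mem_set.
pose F i : set seqs := [set s | V s /\ code s = i].
have Fcyl i : F i = set0 \/ exists2 s, V s & F i = cyl (mkseq s n).
  have [->|/set0P[s [Vs si]]] := eqVneq (F i) set0; [by left|right].
  exists s => //; rewrite cylinderE; apply/seteqP; split=> s' /=.
    by move=> [Vs' s'i]; split; [exact: VS|apply/codeP; rewrite si s'i].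
  by move=> [Ss' ss']; split; [exact: Vn ss' Vs|rewrite -si; apply/esym/codeP].
exists F; split=> //.
- by move=> i; have [->|[s _ ->]] := Fcyl i; [exact: measurable0|exact: measurable_cylinder].
- by move=> i j _ _ [s [[_ <-] [_ <-]]].
- by apply/seteqP; split=> s /= => [[i _ []]//|Vs]; exists (code s).
Qed.

Lemma measurable_prefix_determined n (V : set seqs) : prefix_determined n V -> measurable V.
Proof. by move=> /prefix_determined_partition[F [mF _ <- _]]; exact: bigcupT_measurable. Qed.

Lemma admissible_mkseq n (s : nat -> A) : (0 < n)%N -> S s -> admissible P f (mkseq s n).
Proof.
move=> n0 Ss; apply/andP; split; first by rewrite -size_eq0 size_mkseq -lt0n.
apply/(sortedP point) => i; rewrite size_mkseq => im.
by rewrite !nth_mkseq ?(ltnW im)//; apply/eqP; exact: Ss.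
Qed.

Lemma measurable_iter_shift k :
  measurable_fun [set: seqs] (iter k (@left_shift A) : seqs -> seqs).
Proof.
refine (@measurability _ _ seqs seqs _ _ (@coordinate_sets A) (erefl _) _).
move=> _ [_ [n [a ->]] <-]; rewrite setTI.
rewrite (_ : _ @^-1` _ = [set s : seqs | s (n + k)%N = a]); first exact: measurable_coordinate.
by apply/seteqP; split=> s /=; rewrite iter_left_shift.
Qed.

Lemma measurable_shift_preimage k (B : set seqs) : measurable B ->
  measurable (iter k (@left_shift A) @^-1` B : set seqs).
Proof. by move=> mB; rewrite -[X in measurable X]setTI; exact: measurable_iter_shift. Qed.

End SymbolicSpace.

(** * Consequences of psi-mixing *)

Section PsiMixing.
Variables (R : realType) (A : pointedType) (P : A -> set R) (f : R -> R).
Hypothesis A_countable : countable [set: A].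
Variables (nu : probability (sequence_space A) R) (C1 rho : R) (psi : nat -> R).

Local Notation S := (shift_space P f).
Local Notation cyl := (cylinder P f).
Local Notation seqs := (sequence_space A).
Local Notation sft := (fun k => iter k (@left_shift A)).

Hypothesis rho0 : 0 < rho.
Hypothesis psi_decay : forall k, (0 < k)%N -> psi k <= C1 * expR (- rho * k%:R).
Hypothesis psi_mixing : forall (v w : seq A) (k : nat),
  admissible P f v -> admissible P f w -> (0 < k)%N ->
  `| fine (nu (cyl v `&` sft (size v + k)%N @^-1` cyl w))
     / (fine (nu (cyl v)) * fine (nu (cyl w))) - 1 | <= psi k.

Lemma expR_decay (C : R) : exists N, forall k, (N <= k)%N ->
  C * expR (- rho * k%:R) < 1.
Proof.
have [N hN] := nat_large _ (C / rho); exists N => k /hN; rewrite ler_pdivrMr// => h.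
rewrite mulNr expRN ltr_pdivrMr ?expR_gt0// mul1r.
apply: le_lt_trans h _; have := expR_ge1Dx (rho * k%:R).
by rewrite mulrC; lra.
Qed.

(** For a null cylinder the quotient is [0], as division by [0] gives [0], so the mixing bound would
    read [1 <= psi k] for all [k > 0], against the decay of [psi]. *)
Lemma admissible_cylinder_gt0 v : admissible P f v -> 0 < fine (nu (cyl v)).
Proof.
move=> av; rewrite lt_neqAle fine_ge0 ?measure_ge0// andbT; apply/eqP => v0.
have [N hN] := expR_decay C1.
have := psi_mixing v v N.+1 av av isT.
rewrite -v0 mulr0 invr0 mulr0 sub0r normrN normr1 leNgt => /negP; apply.
by apply: le_lt_trans (psi_decay _ _) (hN N.+1 _).
Qed.

(** Both cylinders have positive measure, so the quotient can be cleared. The measure of the first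
    one is placed in the constant to suit [le_measure_bigcup]. *)
Lemma word_mixing_le (s t : nat -> A) n m k : S s -> S t ->
  (0 < n)%N -> (0 < m)%N -> (0 < k)%N ->
  (nu (cyl (mkseq s n) `&` sft (n + k)%N @^-1` cyl (mkseq t m)) <=
   ((1 + psi k) * fine (nu (cyl (mkseq s n))))%:E * nu (cyl (mkseq t m)))%E.
Proof.
move=> Ss St n0 m0 k0.
have as_ := @admissible_mkseq R A P f _ _ n0 Ss; have at_ := @admissible_mkseq R A P f _ _ m0 St.
have mt := measurable_cylinder R A P f A_countable m t.
have ms := measurable_cylinder R A P f A_countable n s.
have mst : measurable (cyl (mkseq s n) `&` sft (n + k)%N @^-1` cyl (mkseq t m) : set seqs).
  by apply: measurableI => //; exact: measurable_shift_preimage.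
have := psi_mixing _ _ _ as_ at_ k0; rewrite size_mkseq => /ler_normlW h.
have p0 := admissible_cylinder_gt0 _ as_; have q0 := admissible_cylinder_gt0 _ at_.
rewrite -[leLHS](fineK (fin_num_measure nu _ mst)).
rewrite -[X in (_ * X)%E](fineK (fin_num_measure nu _ mt)) -EFinM lee_fin.
rewrite -mulrA -ler_pdivrMr ?mulr_gt0//.
lra.
Qed.

(** Two summations: over the cylinders of [W] behind a fixed prefix, then over the prefixes in [V],
    the two measures exchanging roles in between. *)
Lemma prefix_mixing_le n m k (V W : set seqs) : (0 < n)%N -> (0 < m)%N -> (0 < k)%N ->
  prefix_determined R A P f n V -> prefix_determined R A P f m W ->
  (nu (V `&` sft (n + k)%N @^-1` W) <= ((1 + psi k) * fine (nu W))%:E * nu V)%E.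
Proof.
move=> n0 m0 k0 pV pW.
have mW := measurable_prefix_determined R A P f A_countable _ _ pW.
have mV := measurable_prefix_determined R A P f A_countable _ _ pV.
have msft (B : set seqs) : measurable B -> measurable (sft (n + k)%N @^-1` B : set seqs).
  exact: measurable_shift_preimage.
have step s : S s -> (nu (cyl (mkseq s n) `&` sft (n + k)%N @^-1` W) <=
    ((1 + psi k) * fine (nu (cyl (mkseq s n))))%:E * nu W)%E.
  move=> Ss; have [F [mF tF FW Fcyl]] := prefix_determined_partition R A P f A_countable _ _ pW.
  have mc := measurable_cylinder R A P f A_countable n s.
  rewrite -FW preimage_bigcup setI_bigcupr; apply: le_measure_bigcup => //.
  - by move=> i; apply: measurableI => //; exact: msft.
  - move=> i j _ _ [x [[_ xi] [_ xj]]]; apply: (tF i j I I).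
    by exists (iter (n + k) (@left_shift A) x).
  - move=> i; have [->|[t Wt ->]] := Fcyl i.
      by rewrite preimage_set0 setI0 measure0 mule0.
    by apply: word_mixing_le => //; exact: (pW.1 _ Wt).
have [F [mF tF FV Fcyl]] := prefix_determined_partition R A P f A_countable _ _ pV.
rewrite -FV setI_bigcupl; apply: le_measure_bigcup => //.
- by move=> i; apply: measurableI => //; exact: msft.
- move=> i j _ _ [x [[xi _] [xj _]]]; apply: (tF i j I I).
  by exists x.
- move=> i; have [->|[s Vs ->]] := Fcyl i.
    by rewrite set0I measure0 mule0.
  apply: le_trans (step _ (pV.1 _ Vs)) _.
  have mc := measurable_cylinder R A P f A_countable n s.
  rewrite -[X in (_ * X <= _)%E](fineK (fin_num_measure nu _ mW)).
  rewrite -[X in (_ <= _ * X)%E](fineK (fin_num_measure nu _ mc)) -!EFinM lee_fin.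
  by rewrite mulrAC.
Qed.

(* Consecutive times are [m + m] apart and [W] constrains [m] symbols, which
   leaves a gap of [m] symbols for [psi m] to apply. *)
Definition separated_visits (W : set seqs) (m L : nat) : set seqs :=
  [set s | S s /\ forall l, (l < L)%N -> W (iter (l * (m + m)) (@left_shift A) s)].

(** The last visit begins at time [L * (m + m)] and reads [m] symbols. *)
Lemma prefix_determined_separated_visits (W : set seqs) m L :
  prefix_determined R A P f m W ->
  prefix_determined R A P f (L * (m + m) + m) (separated_visits W m L.+1).
Proof.
move=> [WS Wm]; split=> [s []//|s s' Ss' e [Ss hs]]; split=> // l lL.
apply: Wm (hs l lL); first exact: shift_space_iter.
move=> i im; rewrite !iter_left_shift e//.
by rewrite addnC -addnS leq_add// leq_mul2r -ltnS lL orbT.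
Qed.

(** Induction on the number of visits: the next one begins [m] symbols after the prefix that
    determines the earlier ones, so by mixing it contributes a factor [(1 + psi m) * nu W <= c]. The
    plain bound on [nu W] serves the first visit. *)
Lemma separated_visits_le (W : set seqs) (m L : nat) (c : R) : (0 < m)%N ->
  prefix_determined R A P f m W ->
  fine (nu W) <= c -> (1 + psi m) * fine (nu W) <= c ->
  (nu (separated_visits W m L.+1) <= (c ^+ L.+1)%:E)%E.
Proof.
move=> m0 pW Wc psiWc.
have mW := measurable_prefix_determined R A P f A_countable _ _ pW.
have c0 : 0 <= c by apply: le_trans Wc; rewrite fine_ge0.
elim: L => [|L IH].
  rewrite (_ : separated_visits W m 1 = W).
    by rewrite expr1 -(fineK (fin_num_measure nu _ mW)) lee_fin.
  apply/seteqP; split=> s.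
    by move=> [_ /(_ 0%N isT)].
  by move=> Ws; split; [exact: pW.1|case].
have pV := prefix_determined_separated_visits _ _ L pW.
have mV := measurable_prefix_determined R A P f A_countable _ _ pV.
have -> : separated_visits W m L.+2 =
    separated_visits W m L.+1 `&` sft (L * (m + m) + m + m)%N @^-1` W.
  have -> : (L * (m + m) + m + m = L.+1 * (m + m))%N by lia.
  apply/seteqP; split=> s.
    by move=> [Ss hs]; split; [split=> // l lL; apply: hs; exact: ltnW|exact: hs].
  move=> [[Ss hs] hL]; split=> // l; rewrite ltnS leq_eqVlt => /orP[/eqP->//|]; exact: hs.
apply: le_trans (prefix_mixing_le _ _ _ _ _ _ m0 m0 pV pW) _.
  by rewrite addn_gt0 m0 orbT.
move: IH; rewrite -(fineK (fin_num_measure nu _ mV)) -EFinM !lee_fin => IH.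
rewrite exprS; apply: le_trans (ler_wpM2r _ psiWc) _; first by rewrite fine_ge0.
exact: ler_wpM2l.
Qed.

End PsiMixing.

(** * Coding *)

Section Coding.
Variables (R : realType) (A : pointedType).
Variables (P : A -> set R) (X : set R) (f : R -> R).
Hypothesis f_markov : piecewise_expanding_markov P X f.
Hypothesis A_countable : countable [set: A].

Local Notation S := (shift_space P f).
Local Notation cyl := (cylinder P f).
Local Notation seqs := (sequence_space A).
Local Notation proj := (coding_projection P f).
Local Notation sft := (fun k => iter k (@left_shift A)).

Lemma coded_repeller (s : nat -> A) x : coded_points P f s x -> repeller P X f x.
Proof.
move=> sx; split; first exact: (markov_sub f_markov (sx 0%N)).
by move=> k; exists (s k).
Qed.

Lemma coded_points_iter k (s : nat -> A) x : coded_points P f s x ->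
  coded_points P f (sft k s) (iter k f x).
Proof. by move=> sx i; rewrite iter_left_shift -iterD; exact: sx. Qed.

(** Intervals may share endpoints, so an itinerary has to be chosen; each transition is allowed
    because the orbit itself makes it. *)
Lemma repeller_coded x : repeller P X f x -> exists2 s, S s & coded_points P f s x.
Proof.
move=> [_ Lx]; have /choice[s hs] : forall k, exists a, P a (iter k f x).
  by move=> k; have [a _ Pa] := Lx k; exists a.
exists s => // k; rewrite /transition asboolT//.
by exists (iter k.+1 f x); split; [exists (iter k f x)|exact: hs].
Qed.

Definition missing_orbits (T : nat) (y r : R) : set R :=
  [set x | repeller P X f x /\ forall t, (t < T)%N -> ~ ball y r (iter t f x)].

Lemma measurable_missing_orbits T y r : measurable (missing_orbits T y r).
Proof.
have mL := measurable_repeller R A P X f f_markov A_countable.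
rewrite (_ : missing_orbits T y r = repeller P X f `&`
    \bigcap_(t in [set t | (t < T)%N]) (repeller P X f `&` iter t f @^-1` (~` ball y r))).
  apply: measurableI => //; apply: bigcap_measurableType => t _.
  apply: measurable_iter_preimage => //; apply: measurableC; exact: measurable_ball.
apply/seteqP; split=> x /= [Lx h]; split=> // t tT; first by split=> //; exact: h.
by have [_] := h t tT.
Qed.

Variables (mu : probability (measurableTypeR R) R) (nu : probability seqs R).
Hypothesis mu_nu : symbolic_measure P f mu nu.

Lemma coding_projection_coded s : coded_points P f s !=set0 -> coded_points P f s (proj s).
Proof. by move=> [x sx]; apply: xgetPex; exists x. Qed.

(** By the pushforward formula [V] is compared with the preimage of [B]. Sequences that code no
    point, where the projection takes its default value, lie in the null set [N]. *)
Lemma symbolic_measure_le (V : set seqs) (B : set R) : measurable V -> measurable B ->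
  (forall s, S s -> coded_points P f s (proj s) -> V s -> B (proj s)) ->
  (nu V <= mu B)%E.
Proof.
move=> mV mB VB; have [[N [mN N0 hN]] mproj muE] := mu_nu.
rewrite muE// /pushforward.
have mB' : measurable (proj @^-1` B : set seqs).
  by rewrite -[X in measurable X]setTI; exact: mproj.
rewrite -(measureU0 mB' mN N0); apply: le_measure; rewrite ?inE//.
  exact: measurableU.
move=> s Vs; have [Ns|nNs] := pselect (N s); [by right|left].
have [Ss cs] : S s /\ coded_points P f s !=set0.
  by apply: contrapT => h; apply: nNs; exact: hN.
by apply: VB => //; exact: coding_projection_coded.
Qed.

(** Apply [symbolic_measure_le] to the complements. *)
Lemma symbolic_measure_ge (V : set seqs) (B : set R) : measurable V -> measurable B ->
  (forall s, S s -> coded_points P f s (proj s) -> B (proj s) -> V s) ->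
  (mu B <= nu V)%E.
Proof.
move=> mV mB BV.
have := symbolic_measure_le _ _ (measurableC mV) (measurableC mB).
rewrite !probability_setC//.
have mVf := fin_num_measure nu _ mV; have mBf := fin_num_measure mu _ mB.
rewrite -(fineK mVf) -(fineK mBf) -!EFinB !lee_fin => h.
have : 1 - fine (nu V) <= 1 - fine (mu B) :> R.
  by apply: h => s Ss cs nVs Bs; apply: nVs; exact: BV.
lra.
Qed.

Variables (C1 rho gamma : R) (psi : nat -> R).
Hypothesis rho0 : 0 < rho.
Hypothesis psi_decay : forall k, (0 < k)%N -> psi k <= C1 * expR (- rho * k%:R).
Hypothesis psi_mixing : forall (v w : seq A) (k : nat),
  admissible P f v -> admissible P f w -> (0 < k)%N ->
  `| fine (nu (cyl v `&` sft (size v + k)%N @^-1` cyl w))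
     / (fine (nu (cyl v)) * fine (nu (cyl w))) - 1 | <= psi k.
Hypothesis gamma1 : 1 < gamma.
Hypothesis itinerary_close : forall m (s : nat -> A) (x y : R), X x -> X y ->
  (forall i, (i < m)%N -> P (s i) (iter i f x) /\ P (s i) (iter i f y)) ->
  gamma ^+ m * `|x - y| <= 1.

Lemma coded_close m (s s' : nat -> A) x x' :
  coded_points P f s x -> coded_points P f s' x' ->
  (forall i, (i < m)%N -> s i = s' i) -> gamma ^+ m * `|x - x'| <= 1.
Proof.
move=> sx s'x' e; apply: (itinerary_close m s).
- exact: (coded_repeller _ _ sx).1.
- exact: (coded_repeller _ _ s'x').1.
- by move=> i im; split; [exact: sx|rewrite e//; exact: s'x'].
Qed.

Lemma gamma_large (K : R) : exists N, forall m, (N <= m)%N -> K < gamma ^+ m.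
Proof.
have lg : 0 < ln gamma by rewrite ln_gt0.
have [N hN] := nat_large _ (K / ln gamma); exists N => m /hN; rewrite ler_pdivrMr// => h.
have -> : gamma ^+ m = expR (m%:R * ln gamma).
  by rewrite expRM_natl lnK// posrE (lt_trans _ gamma1).
by apply: le_lt_trans h _; have := expR_ge1Dx (m%:R * ln gamma); lra.
Qed.

(* Admissible cylinders have positive measure, as psi-mixing excludes a zero
   denominator. *)
Lemma repeller_support y : repeller P X f y -> measure_support mu y.
Proof.
move=> Ly U oU Uy; have [s Ss sy] := repeller_coded _ Ly.
have /nbhs_ballP[e /= e0 hU] : nbhs y U by exact: open_nbhs_nbhs.
(* From this [N] on, [gamma ^ (-m) < e], so the [m]-cylinder of the itinerary of [y] projects into
   the ball of radius [e]. The successor makes [m] positive, as admissible words are nonempty. *)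
have [N hN] := gamma_large (1 / e).
pose m := N.+1.
have adm : admissible P f (mkseq s m) by exact: admissible_mkseq.
have mc := measurable_cylinder R A P f A_countable m s.
have cgt0 : (0 < nu (cyl (mkseq s m)))%E.
  rewrite -(fineK (fin_num_measure nu _ mc)) lte_fin.
  exact: (admissible_cylinder_gt0 R A P f nu C1 rho psi rho0 psi_decay psi_mixing).
apply: (lt_le_trans cgt0); apply: symbolic_measure_le => //.
  exact: open_measurable.
move=> s' Ss' cs'; rewrite cylinderE => -[_ ss']; apply: hU.
rewrite -ball_normE /=; have g := hN m (leqnSn _).
have := coded_close m _ _ _ _ sy cs' ss'.
rewrite ltr_pdivrMr// in g.
have g0 : 0 < gamma ^+ m by rewrite exprn_gt0// (lt_trans _ gamma1).
by move=> h; rewrite -(ltr_pM2l g0); apply: le_lt_trans h _.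
Qed.

(** If an orbit misses the ball, the shifts of its code at the times [l * (m + m)], [l <= L], all
    fall in [W]: sharing [m] symbols with a point of the half ball means being within [r / 2] of it.
    Mixing bounds the probability of this; weakening [1 - p] to [1 - p / 2] pays for the error
    [psi m]. *)
Lemma missing_orbits_le (m L : nat) (y r p : R) : (0 < m)%N -> 0 < r ->
  1 <= gamma ^+ m * (r / 2) -> 0 <= p -> (p%:E <= mu (ball y (r / 2)))%E -> psi m <= p / 2 ->
  (mu (missing_orbits (L * (m + m) + 1) y r) <= ((1 - p / 2) ^+ L.+1)%:E)%E.
Proof.
move=> m0 r0 gm p0 pmu psip.
(* The complement of [W] is a union of [m]-cylinders lying between the balls
   of radii [r / 2] and [r]. *)
pose near (s : nat -> A) := exists s' x', [/\ coded_points P f s' x',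
  ball y (r / 2) x' & forall i, (i < m)%N -> s i = s' i].
pose W : set seqs := [set s | S s /\ ~ near s].
have pW : prefix_determined R A P f m W.
  split=> [s []//|s s' Ss' e [Ss ns]]; split=> // -[t [x [tx yx s't]]].
  by apply: ns; exists t, x; split=> // i im; rewrite e// s't.
have mW := measurable_prefix_determined R A P f A_countable _ _ pW.
have mb : measurable (ball y (r / 2) : set (measurableTypeR R)) by exact: measurable_ball.
have mD : measurable (missing_orbits (L * (m + m) + 1) y r : set (measurableTypeR R)).
  exact: measurable_missing_orbits.
have W_le : fine (nu W) <= 1 - p.
  have {}pmu : p <= fine (mu (ball y (r / 2))).
    by rewrite -lee_fin fineK// fin_num_measure.
  have := symbolic_measure_le W (~` ball y (r / 2)) mW (measurableC mb).
  rewrite probability_setC//.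
  rewrite -(fineK (fin_num_measure mu _ mb)) -(fineK (fin_num_measure nu _ mW)).
  rewrite -EFinB lee_fin => h.
  apply: le_trans (h _) _; last by rewrite lerD2l lerN2.
  by move=> s Ss cs [_ ns] ys; apply: ns; exists s, (proj s).
have W_ge0 : 0 <= fine (nu W) by rewrite fine_ge0.
have c1 : fine (nu W) <= 1 - p / 2 by lra.
(* [(1 + p / 2) * (1 - p) = 1 - p / 2 - p ^ 2 / 2]. *)
have c2 : (1 + psi m) * fine (nu W) <= 1 - p / 2.
  apply: (@le_trans _ _ ((1 + p / 2) * (1 - p))).
    apply: (@le_trans _ _ ((1 + p / 2) * fine (nu W))); first by rewrite ler_wpM2r//; lra.
    by rewrite ler_wpM2l//; lra.
  have : 0 <= p * p by rewrite mulr_ge0.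
  lra.
apply: le_trans (separated_visits_le R A P f A_countable nu C1 rho psi rho0 psi_decay psi_mixing
  W m L _ m0 pW c1 c2).
have mV := measurable_prefix_determined R A P f A_countable _ _
  (prefix_determined_separated_visits R A P f _ _ L pW).
apply: symbolic_measure_ge => // s Ss cs [_ hD]; split=> // l lL; split.
  exact: shift_space_iter.
move=> [s' [x' [s'x' yx' ss']]].
(* The [+ 1] in the time bound admits the last block, which starts at time [L * (m + m)]. *)
have lT : (l * (m + m) < L * (m + m) + 1)%N by rewrite addn1 ltnS leq_mul2r -ltnS lL orbT.
apply: (hD _ lT).
have h := coded_close m _ _ _ _ (coded_points_iter (l * (m + m)) _ _ cs) s'x' ss'.
have g0 : 0 < gamma ^+ m by rewrite exprn_gt0// (lt_trans _ gamma1).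
have {}h : `|iter (l * (m + m)) f (proj s) - x'| <= r / 2.
  by rewrite -(ler_pM2l g0); exact: le_trans h gm.
move: yx'; rewrite -!ball_normE /= => yx'.
rewrite (splitr r) (_ : y - _ = (y - x') + (x' - iter (l * (m + m)) f (proj s))); last by ring.
by apply: le_lt_trans (ler_normD _ _) _; rewrite ltr_leD// distrC.
Qed.

End Coding.

(** * Lower bound on the cover time *)

Section LogRatios.
Variable R : realType.

(** Since [- ln r] tends to infinity, division by it removes both the constant [K] and the shift by
    [ln a] that the dilation causes; the gap between [c] and [c'] makes this quantitative. *)
Lemma log_ratio_dilate_le (H1 H2 : R -> \bar R) (a K : R) : 0 < a ->
  (\forall r \near (0 : R)^'+, H2 (a * r)%R <= H1 r + K%:E)%E ->
  (limf_einf (fun r => H2 r / (- ln r)%:E) (0 : R)^'+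
     <= limf_einf (fun r => H1 r / (- ln r)%:E) (0 : R)^'+)%E /\
  (limf_esup (fun r => H2 r / (- ln r)%:E) (0 : R)^'+
     <= limf_esup (fun r => H1 r / (- ln r)%:E) (0 : R)^'+)%E.
Proof.
move=> a0 /near_right0P[e e0 he].
apply: (limf_dilate_le _ _ _ a) => // c c' cc'; apply/near_right0P.
(* The bounds [1] and [a^-1] make both denominators positive; the last one gives
   [(c' - c) * - ln r >= c' * ln a + K]. *)
exists (Num.min (Num.min e 1) (Num.min a^-1 (expR (- ((c' * ln a + K) / (c' - c)))))).
  by rewrite !lt_min e0 ltr01 invr_gt0 a0 expR_gt0.
move=> r r0; rewrite !lt_min => /andP[/andP[re r1] /andP[ra rK]].
have lr : 0 < - ln r by rewrite oppr_gt0 ln_lt0// r0.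
have lar : 0 < - ln (a * r).
  by rewrite oppr_gt0 ln_lt0// mulr_gt0//= mulrC -ltr_pdivlMr// div1r.
rewrite !inver !gt_eqF// !lee_pdivlMr// => h.
have {}h := le_trans h (he _ r0 re).
rewrite -EFinM -leeBlDr// -EFinB in h.
rewrite -EFinM; apply: le_trans h; rewrite lee_fin lnM ?posrE//.
have lK : (c' * ln a + K) / (c' - c) <= - ln r.
  by rewrite lerNr -[leRHS]expRK ler_ln ?posrE ?expR_gt0// ltW.
rewrite ler_pdivrMr ?subr_gt0// in lK.
have -> : c' * - (ln a + ln r) - K = - ln r * (c' - c) - (c' * ln a + K) + c * - ln r by ring.
by rewrite lerDr subr_ge0.
Qed.

Lemma lne_le (x y : \bar R) : (x <= y)%E -> (lne x <= lne y)%E.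
Proof.
move=> xy; have [x0|x0] := leP x 0%E; first by rewrite (le0_lneNy x0) leNye.
by rewrite lee_lne// in_itv/= leey ?andbT ltW//; apply: lt_le_trans xy.
Qed.

Lemma lne_lne_expR (l : R) : 0 < l -> lne (lne (expR l)%:E) = (ln l)%:E.
Proof. by move=> l0; rewrite !lne_EFin ?expRK ?expR_gt0. Qed.

Lemma lne_abse_lne_expRN (l : R) : 0 < l -> lne `|lne (expR (- l))%:E|%E = (ln l)%:E.
Proof. move=> l0; rewrite (lne_EFin (expR_gt0 _)) expRK.
by rewrite abse_EFin normrN gtr0_norm// lne_EFin. Qed.

End LogRatios.

Section CoverTime.
Variables (R : realType) (A : pointedType).
Variables (P : A -> set R) (X : set R) (f : R -> R).

Local Notation tau := (cover_time P X f).

Lemma cover_time_le (r r' x : R) : r <= r' -> (tau r' x <= tau r x)%E.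
Proof.
move=> rr'; apply: ereal_inf_le_tmp => _ [k hk <-]; exists k => //= y Ly.
by have [j jk h] := hk y Ly; exists j => //; exact: lt_le_trans rr'.
Qed.

Lemma cover_time_lt (r x T : R) : (tau r x < T%:E)%E ->
  exists2 k : nat, k%:R < T &
    forall y, repeller P X f y -> exists2 j, (j <= k)%N & `|iter j f x - y| < r.
Proof. by move=> /ereal_inf_lt[_ [k hk <-]]; rewrite lte_fin => kT; exists k. Qed.

Lemma cover_time_le_nat (r x : R) (k : nat) :
  (forall y, repeller P X f y -> exists2 j, (j <= k)%N & `|iter j f x - y| < r) ->
  (tau r x <= k%:R%:E)%E.
Proof. by move=> h; apply: ereal_inf_lbound; exists k. Qed.

End CoverTime.

Lemma eventually_at_scales (R : realType) (Q : R -> Prop) (N : nat) :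
  (forall n r, (N <= n)%N -> 2^-1 ^+ n.+1 <= r -> r < 2^-1 ^+ n -> Q r) ->
  \forall r \near (0 : R)^'+, Q r.
Proof.
move=> h; apply/near_right0P; exists (2^-1 ^+ N); first exact: half_pow_gt0.
move=> r r0 rN; have [n Nn /andP[]] := dyadic_scale _ _ _ r0 rN.
exact: h.
Qed.

(** * Visits to balls of nearly minimal measure *)

Section Bounds.
Variables (R : realType) (A : pointedType).
Variables (P : A -> set R) (X : set R) (f : R -> R).
Variable mu : probability (measurableTypeR R) R.
Hypothesis f_markov : piecewise_expanding_markov P X f.
Hypothesis A_countable : countable [set: A].
Hypothesis mu_repeller : mu (repeller P X f) = 1%E.
Hypothesis mu_invariant : invariant_measure P X f mu.

Local Notation M := (min_ball_measure mu).
Local Notation tau := (cover_time P X f).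

Variables (r0 s : R) (ell : R -> R).
Hypothesis r0_gt0 : 0 < r0.
Hypothesis s_gt0 : 0 < s.
Hypothesis ell_ge : forall r : R, 0 < r -> r < r0 -> expR (s * - ln r) <= ell r.
Hypothesis M_ell : forall r : R, 0 < r -> r < r0 -> M r = (expR (- ell r))%:E.

Lemma ell_gt0 r : 0 < r -> r < r0 -> 0 < ell r.
Proof. by move=> rp rr; apply: lt_le_trans (ell_ge _ rp rr); exact: expR_gt0. Qed.

Lemma ell_le r r' : 0 < r -> r <= r' -> r' < r0 -> ell r' <= ell r.
Proof.
move=> rp rr' rr0; have := min_ball_measure_le R mu _ _ rr'.
have r'p := lt_le_trans rp rr'; have rr := le_lt_trans rr' rr0.
rewrite !M_ell//.
by rewrite lee_fin ler_expR lerN2.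
Qed.

Lemma expRN_le_half_pow (n : nat) (l : R) : n%:R <= l -> expR (- l) <= 2^-1 ^+ n.
Proof.
move=> nl; apply: (@le_trans _ _ (expR (- n%:R))); first by rewrite ler_expR lerN2.
rewrite -(mulr1 n%:R) expRN expRM_natl -exprVn; apply: lerXn2r.
- by rewrite nnegrE invr_ge0 expR_ge0.
- by rewrite nnegrE invr_ge0.
- by rewrite lef_pV2 ?posrE ?expR_gt0//; have := expR_ge1Dx (1 : R); lra.
Qed.

Definition visits (K : nat) (y r : R) : set (measurableTypeR R) :=
  \big[setU/set0]_(j < K) (repeller P X f `&` iter j f @^-1` ball y r).

Lemma visitsP K y r x : visits K y r x <->
  repeller P X f x /\ exists2 j, (j < K)%N & ball y r (iter j f x).
Proof.
rewrite /visits -(bigcup_mkord _ (fun j => repeller P X f `&` iter j f @^-1` ball y r)).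
by split=> [[j jK [Lx yx]]|[Lx [j jK yx]]]; [split=> //|]; exists j.
Qed.

Lemma measurable_visits K y r : measurable (visits K y r).
Proof.
apply: bigsetU_measurable => j _; apply: measurable_iter_preimage => //.
exact: measurable_ball.
Qed.

(** The union bound; by invariance each time contributes the measure of the ball. *)
Lemma visits_measure_le K y r : (mu (visits K y r) <= K%:R%:E * mu (ball y r))%E.
Proof.
pose F j : set (measurableTypeR R) := repeller P X f `&` iter j f @^-1` ball y r.
have mF j : (j < K)%N -> measurable (F j).
  by move=> _; apply: measurable_iter_preimage => //; exact: measurable_ball.
apply: le_trans (Boole_inequality mu mF) _.
have mb : measurable (ball y r : set (measurableTypeR R)) by exact: measurable_ball.
rewrite (eq_bigr (fun=> (fine (mu (ball y r)))%:E)) => [|j _]; last first.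
  by rewrite fineK ?fin_num_measure//; exact: invariant_iter.
rewrite sumEFin sumr_const card_ord -[X in (_ <= _ * X)%E]fineK ?fin_num_measure//.
by rewrite -EFinM lee_fin mulr_natl.
Qed.

(** [E n] is an early visit to a ball of radius [2 ^ (-n)] whose measure is at most twice the
    minimum. With about [exp (ell / 2)] times allowed, its probability is at most
    [4 * exp (- ell / 2)], so almost every orbit avoids all but finitely many [E n], whereas a
    faster cover at a nearby scale would force such a visit. *)
Lemma cover_time_ge_ae : {ae mu, forall x, repeller P X f x ->
  \forall r \near (0 : R)^'+, ((expR (ell (4 * r) / 2))%:E <= tau r x)%E}.
Proof.
(* The slope [2] makes [exp (- ell / 2)] at most [2 ^ (-n)]. *)
have [N hN] := dyadic_superlinear _ _ _ _ 2 r0_gt0 s_gt0 ell_ge.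
(* The factor [2] puts the bound strictly above the infimum, so some support point meets it; [0] is
   a placeholder for [n < N]. *)
have /choice[y hy] : forall n, exists y, (N <= n)%N -> measure_support mu y /\
    (mu (ball y (2^-1 ^+ n)) <= (2 * expR (- ell (2^-1 ^+ n)))%:E)%E.
  move=> n; have [Nn|] := leqP N n; last by exists 0.
  have [nr0 _] := hN n Nn.
  have : (M (2^-1 ^+ n) < (2 * expR (- ell (2^-1 ^+ n)))%:E)%E.
    rewrite M_ell ?half_pow_gt0// lte_fin ltr_pMl ?expR_gt0//; lra.
  by move=> /ereal_inf_lt[_ [y ys <-] /ltW h]; exists y.
pose K n := (Num.truncn (expR (ell (2^-1 ^+ n) / 2))).+1.
pose E n := visits (K n) (y n) (2^-1 ^+ n).
have mE n : measurable (E n) by exact: measurable_visits.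
have E_le n : (N <= n)%N -> (mu (E n) <= (4 * 2^-1 ^+ n)%:E)%E.
  move=> Nn; have [ys muy] := hy n Nn; have [nr0 elln] := hN n Nn.
  apply: le_trans (visits_measure_le _ _ _) _.
  set l := ell _ in muy elln *; have l0 : 0 < l by exact: ell_gt0 _ (half_pow_gt0 _ _) nr0.
  apply: le_trans (lee_wpmul2l _ muy) _; first by rewrite lee_fin.
  rewrite -EFinM lee_fin; set q := expR (l / 2).
  have q1 : 1 <= q by rewrite -expR0 ler_expR; lra.
  have Kq : (K n)%:R <= 2 * q.
    have : (Num.truncn q)%:R <= q by rewrite truncn_le expR_ge0.
    by rewrite -[K n]addn1 natrD -/q; lra.
  have -> : expR (- l) = q^-1 * q^-1 by rewrite /q -!expRN -expRD; congr expR; lra.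
  apply: le_trans (ler_wpM2r _ Kq) _; first by rewrite !mulr_ge0// invr_ge0 expR_ge0.
  have -> : 2 * q * (2 * (q^-1 * q^-1)) = 4 * q^-1 by field; rewrite gt_eqF// expR_gt0.
  rewrite ler_pM2l ?ltr0n// /q -expRN; apply: expRN_le_half_pow; lra.
apply: filterS (eventually_notin_of_geometric _ _ _ mu E 4 N mE E_le) => x [N' hN'] Lx.
apply: (@eventually_at_scales _ _ (maxn N N').+2) => -[//|[//|k]] r.
(* Here [2 ^ (-(n + 2)) <= r < 2 ^ (-(n + 1))], so [4 * r] lies between [2 ^ (-n)] and
   [2 ^ (-k) < r0], and [r + 2 ^ (-(n + 1)) < 2 ^ (-n)] for the final triangle inequality. *)
rewrite !ltnS geq_max; set n := k.+1 => /andP[Nk N'k] nr rn.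
have Nn : (N <= n)%N := leqW Nk; have N'n : (N' <= n)%N := leqW N'k.
have [kr0 _] := hN k Nk.
have hp j : 2^-1 ^+ j.+1 = 2^-1 ^+ j / 2 :> R by rewrite exprSr.
have n4r : 2^-1 ^+ n <= 4 * r by rewrite !hp in nr *; lra.
have r4 : 4 * r < r0 by apply: lt_trans kr0; rewrite !hp in rn; lra.
have r_gt0 : 0 < r by apply: lt_le_trans nr; exact: half_pow_gt0.
rewrite leNgt; apply/negP => /cover_time_lt[i iT cov].
have [y' Ly' yy'] := support_ball_repeller R A P X f f_markov A_countable mu mu_repeller
  _ _ (hy n Nn).1 (half_pow_gt0 R n.+1).
have [j jk jy'] := cov y' Ly'.
apply: (hN' n N'n); apply/visitsP; split=> //; exists j.
  rewrite /K ltnS (leq_trans jk)// truncn_ge_nat ?expR_ge0//.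
  apply/ltW/(lt_le_trans iT); rewrite ler_expR ler_pM2r ?invr_gt0//.
  exact: ell_le _ _ (half_pow_gt0 _ _) n4r r4.
move: yy'; rewrite -!ball_normE /= => yy'.
rewrite (_ : y n - _ = (y n - y') - (iter j f x - y')); last by ring.
apply: le_lt_trans (ler_normB _ _) _; move: yy' rn; rewrite !hp => yy' rn.
by lra.
Qed.

End Bounds.

(** * Upper bound on the cover time *)

Section UpperBound.
Variables (R : realType) (A : pointedType).
Variables (P : A -> set R) (X : set R) (f : R -> R).
Variable mu : probability (measurableTypeR R) R.
Hypothesis f_markov : piecewise_expanding_markov P X f.
Hypothesis A_countable : countable [set: A].
Hypothesis mu_repeller : mu (repeller P X f) = 1%E.

Local Notation M := (min_ball_measure mu).
Local Notation tau := (cover_time P X f).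

Variables (r0 s : R) (ell : R -> R).
Hypothesis r0_gt0 : 0 < r0.
Hypothesis s_gt0 : 0 < s.
Hypothesis ell_ge : forall r : R, 0 < r -> r < r0 -> expR (s * - ln r) <= ell r.
Hypothesis M_ell : forall r : R, 0 < r -> r < r0 -> M r = (expR (- ell r))%:E.

Variables (nu : probability (sequence_space A) R).
Hypothesis mu_nu : symbolic_measure P f mu nu.
Variables (C1 rho gamma : R) (psi : nat -> R).
Hypothesis rho0 : 0 < rho.
Hypothesis psi_decay : forall k, (0 < k)%N -> psi k <= C1 * expR (- rho * k%:R).
Hypothesis psi_mixing : forall (v w : seq A) (k : nat),
  admissible P f v -> admissible P f w -> (0 < k)%N ->
  `| fine (nu (cylinder P f v `&` iter (size v + k)%N (@left_shift A) @^-1` cylinder P f w))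
     / (fine (nu (cylinder P f v)) * fine (nu (cylinder P f w))) - 1 | <= psi k.
Hypothesis gamma1 : 1 < gamma.
Hypothesis itinerary_close : forall m (s : nat -> A) (x y : R), X x -> X y ->
  (forall i, (i < m)%N -> P (s i) (iter i f x) /\ P (s i) (iter i f y)) ->
  gamma ^+ m * `|x - y| <= 1.

(** [exp (rho * m)] is at least [(rho * m / 2) ^ 2], hence at least [2 * C1 * m] once
    [m >= 8 * C1 / rho ^ 2]. The target is [p / 2] for a ball of measure at least [p = 1 / m]. *)
Lemma psi_small : exists N : nat, forall m, (N <= m)%N -> (0 < m)%N ->
  psi m <= m%:R^-1 / 2.
Proof.
have [N hN] := nat_large _ (8 * C1 / rho ^+ 2); exists N => m /hN Nm m0.
apply: le_trans (psi_decay _ m0) _.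
have m0' : 0 < m%:R :> R by rewrite ltr0n.
rewrite mulNr expRN ler_pdivrMr ?expR_gt0// -invfM mulrC ler_pdivlMr ?mulr_gt0//.
apply: le_trans (sqr_le_expR _ (rho * m%:R) _); last by rewrite mulr_ge0// ltW.
rewrite ler_pdivrMr ?exprn_gt0// in Nm.
have -> : (rho * m%:R / 2) ^+ 2 = (m%:R * rho ^+ 2) * m%:R / 4 by field.
have := ler_wpM2r (ltW m0') Nm; lra.
Qed.

(** [gamma ^ m >= m * ln gamma >= 4 ^ n * ln gamma], and [2 ^ n * ln gamma >= 1] for large [n]. This
    makes cylinders of [m] symbols as fine as [2 ^ (-n)]. *)
Lemma gamma_ge : exists N : nat, forall n m, (N <= n)%N -> 2 ^+ n * 2 ^+ n <= m%:R :> R ->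
  2 ^+ n <= gamma ^+ m.
Proof.
have lg : 0 < ln gamma by rewrite ln_gt0.
have [N hN] := nat_large _ (1 / ln gamma); exists N => n m /hN; rewrite ler_pdivrMr// => nl nm.
have -> : gamma ^+ m = expR (m%:R * ln gamma).
  by rewrite expRM_natl lnK// posrE (lt_trans _ gamma1).
apply: (@le_trans _ _ (m%:R * ln gamma)); last first.
  by have := expR_ge1Dx (m%:R * ln gamma); lra.
apply: le_trans (ler_wpM2r (ltW lg) nm); rewrite -mulrA ler_peMr ?exprn_ge0//.
apply: le_trans nl _; rewrite ler_wpM2r ?(ltW lg)// -natrX ler_nat.
exact/ltnW/ltn_expl.
Qed.

(** [2 * k ^ 3 + 1 <= 3 * k ^ 3 <= k ^ 4]. *)
Lemma block_count_le (k : nat) : (3 <= k)%N -> (k * k * (k + k) + 1 <= k ^ 4)%N.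
Proof.
move=> k3; have -> : (k ^ 4 = k * (k * k * k))%N by rewrite !expnS expn0 muln1 !mulnA.
have c0 : (0 < k * k * k)%N by rewrite !muln_gt0 (leq_trans _ k3).
apply: leq_trans (leq_mul k3 (leqnn _)); rewrite mulnDr.
by move: (k * k * k)%N c0 => c; lia.
Qed.

(** The block estimate with [p = 1 / m] and [L = m ^ 2]: [(1 - p / 2) ^ (m ^ 2 + 1) <= exp (- p * (m
    ^ 2 + 1) / 2) <= exp (- m / 2)]. *)
Lemma missing_orbits_exp_le (m : nat) (y r : R) : (0 < m)%N -> 0 < r ->
  1 <= gamma ^+ m * (r / 2) -> ((m%:R^-1)%:E <= mu (ball y (r / 2)))%E ->
  psi m <= m%:R^-1 / 2 ->
  (mu (missing_orbits R A P X f (m * m * (m + m) + 1) y r) <= (expR (- (m%:R / 2)))%:E)%E.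
Proof.
move=> m0 rp gm pmu psip; have m0' : 0 < m%:R :> R by rewrite ltr0n.
apply: le_trans (missing_orbits_le R A P X f f_markov A_countable mu nu mu_nu C1 rho gamma psi
  rho0 psi_decay psi_mixing gamma1 itinerary_close _ _ _ _ _ m0 rp gm _ pmu psip) _.
  by rewrite invr_ge0 ltW.
have m1 : m%:R^-1 <= 1 :> R by rewrite invf_le1// ler1n.
rewrite lee_fin; set p := m%:R^-1 in m1 *.
apply: (@le_trans _ _ (expR (- (p / 2)) ^+ (m * m).+1)).
  apply: lerXn2r; rewrite ?nnegrE ?expR_ge0//; first by lra.
  by have := expR_ge1Dx (- (p / 2)); lra.
rewrite -expRM_natl ler_expR mulrN lerN2 -[(m * m).+1]addn1 natrD natrM.
have -> : (m%:R * m%:R + 1) * (p / 2) = m%:R * (m%:R * p) / 2 + p / 2 by ring.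
by rewrite /p mulfV ?gt_eqF// mulr1 lerDl divr_ge0// invr_ge0 ltW.
Qed.

(** A net of the repeller with one point per dyadic cell of length [2 ^ (-n)]. Cells that miss the
    repeller get [x0], so all net points lie in the repeller when [x0] does. *)
Definition cell_point (x0 : R) (n j : nat) : R :=
  xget x0 [set z | repeller P X f z /\ Num.truncn (z * 2 ^+ n) = j].

Lemma cell_point_repeller x0 n j : repeller P X f x0 -> repeller P X f (cell_point x0 n j).
Proof. by rewrite /cell_point; case: xgetP => [z _ []|]. Qed.

Lemma cell_point_close x0 n y : repeller P X f y ->
  exists2 j : nat, (j < (2 ^ n).+1)%N & `|cell_point x0 n j - y| < 2^-1 ^+ n.
Proof.
move=> Ly; have L01 z : repeller P X f z -> 0 <= z <= 1.
  by move=> [/(markov_domain01 f_markov)]; rewrite /= in_itv.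
have p0 : 0 < 2 ^+ n :> R by rewrite exprn_gt0.
have trunc z : repeller P X f z ->
    (Num.truncn (z * 2 ^+ n))%:R <= z * 2 ^+ n < (Num.truncn (z * 2 ^+ n)).+1%:R.
  by move=> /L01/andP[z0 _]; rewrite truncn_itv// mulr_ge0// ltW.
(* The point [1] would fall in cell number [2 ^ n], whence one cell more than [2 ^ n]. *)
exists (Num.truncn (y * 2 ^+ n)).
  have /andP[y0 y1] := L01 _ Ly; rewrite truncn_lt_nat ?mulr_ge0 ?(ltW p0)//.
  apply: (@le_lt_trans _ _ (2 ^ n)%:R); last by rewrite ltr_nat.
  by rewrite natrX ler_piMl// ltW.
set j := Num.truncn _; have [] : repeller P X f (cell_point x0 n j) /\
    Num.truncn (cell_point x0 n j * 2 ^+ n) = j.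
  apply: (@xgetPex R x0 [set z | repeller P X f z /\ Num.truncn (z * 2 ^+ n) = j]).
  by exists y.
set z := cell_point _ _ _ => Lz zj.
have := trunc _ Lz; have := trunc _ Ly; rewrite zj -/j -addn1 natrD.
move=> /andP[jy yj] /andP[jz zj'].
rewrite exprVn -(ltr_pM2r p0) mulVf ?gt_eqF// -(gtr0_norm p0) -normrM mulrBl.
by rewrite ltr_norml; apply/andP; split; lra.
Qed.

(** [D n] means that some net ball of radius [2 ^ (-(n + 1))] is missed before time [T n]. The
    concentric balls of half the radius have measure at least [exp (- l n) >= 1 / m n], so the block
    estimate makes [D n] summable. Outside [D n] the orbit covers at scale [2 ^ (-n)] by time
    [T n <= m n ^ 4 <= exp (8 * l n)]. *)
Lemma cover_time_le_ae : {ae mu, forall x, repeller P X f x ->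
  \forall r \near (0 : R)^'+, (tau (8 * r)%R x <= (expR (8 * ell r))%:E)%E}.
Proof.
(* The slope [4] gives [m n / 2 >= 2 * (n + 2)], hence a probability at most [4 ^ (-(n + 2))] for
   each ball, and also [4 ^ (n + 2) <= m n] for [gamma_ge]. *)
have [N1 hN1] := dyadic_superlinear _ _ _ _ 4 r0_gt0 s_gt0 ell_ge.
have [N2 hN2] := psi_small; have [N3 hN3] := gamma_ge.
have [x0 Lx0] : repeller P X f !=set0.
  apply/set0P/eqP => L0; move: mu_repeller; rewrite L0 measure0.
  by move=> /esym/eqP; rewrite onee_eq0.
pose l n := ell (2^-1 ^+ n.+2).
pose m n := (Num.truncn (expR (l n))).+1.
pose T n := (m n * m n * (m n + m n) + 1)%N.
pose D n : set (measurableTypeR R) := \big[setU/set0]_(j < (2 ^ n.+1).+1)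
  missing_orbits R A P X f (T n) (cell_point x0 n.+1 j) (2^-1 ^+ n.+1).
have mD n : measurable (D n).
  by apply: bigsetU_measurable => j _; exact: measurable_missing_orbits.
pose N := maxn N1 (maxn N2 N3).
have facts n : (N <= n)%N -> [/\ 2^-1 ^+ n.+2 < r0, 4 * n.+2%:R <= l n :> R,
    expR (l n) <= (m n)%:R, (m n)%:R <= expR (2 * l n) :> R & 1 + l n <= (m n)%:R :> R].
  rewrite geq_max => /andP[n1 _].
  have [rn ln] := hN1 n.+2 (leqW (leqW n1)).
  have l1 : 1 <= l n by apply: le_trans ln; rewrite -natrM ler1n.
  have em : expR (l n) <= (m n)%:R.
    by apply: ltW; apply: truncnS_gt.
  have el := expR_ge1Dx (l n).
  split=> //; last exact: le_trans em.
  have me : (m n)%:R <= expR (l n) + 1.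
    by rewrite /m -addn1 natrD lerD2r truncn_le expR_ge0.
  have -> : expR (2 * l n) = expR (l n) * expR (l n).
    by rewrite -expRD; congr expR; ring.
  apply: le_trans me _; have e2 : 2 <= expR (l n) by lra.
  have := ler_wpM2l (expR_ge0 (l n)) e2; lra.
have D_le n : (N <= n)%N -> (mu (D n) <= (1 * 2^-1 ^+ n)%:E)%E.
  move=> Nn; have [rn ln em _ lm] := facts n Nn.
  move: Nn; rewrite !geq_max => /and3P[_ n2 n3].
  have l_m2 : 2 * n.+2%:R <= (m n)%:R / 2 :> R by lra.
  have nm : (n <= m n)%N by rewrite -(ler_nat R); move: ln lm; rewrite -[n.+2]addn2 natrD; have := ler0n R n; lra.
  have gm : 1 <= gamma ^+ m n * (2^-1 ^+ n.+1 / 2).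
    rewrite -exprSr exprVn ler_pdivlMr ?exprn_gt0// mul1r; apply: hN3.
      exact: leqW (leqW n3).
    apply: le_trans em; rewrite -exprD -[leRHS]invrK -expRN -[leLHS]invrK -exprVn.
    rewrite lef_pV2 ?posrE ?expR_gt0 ?half_pow_gt0//.
    by apply: expRN_le_half_pow; move: ln; rewrite natrD; have := ler0n R n.+2; lra.
  pose F j : set (measurableTypeR R) :=
    missing_orbits R A P X f (T n) (cell_point x0 n.+1 j) (2^-1 ^+ n.+1).
  have mF j : (j < (2 ^ n.+1).+1)%N -> measurable (F j).
    by move=> _; exact: measurable_missing_orbits.
  apply: le_trans (Boole_inequality mu mF) _.
  have FE j : (mu (F j) <= (2^-1 ^+ (n.+2 + n.+2))%:E)%E.
    apply: le_trans (missing_orbits_exp_le (m n) _ _ _ _ gm _ _) _ => //.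
    - rewrite -exprSr; apply: (@le_trans _ _ (M (2^-1 ^+ n.+2))).
        rewrite M_ell ?half_pow_gt0// lee_fin expRN lef_pV2 ?posrE ?expR_gt0 ?ltr0n//.
      apply: ereal_inf_lbound; exists (cell_point x0 n.+1 j) => //.
      apply: (repeller_support R A P X f f_markov A_countable mu nu mu_nu C1 rho gamma psi
        rho0 psi_decay psi_mixing gamma1 itinerary_close).
      exact: cell_point_repeller.
    - by apply: hN2 => //; exact: leq_trans nm.
    - by rewrite lee_fin; apply: expRN_le_half_pow; rewrite natrD; lra.
  apply: (@le_trans _ _ (\sum_(j < (2 ^ n.+1).+1) (2^-1 ^+ (n.+2 + n.+2))%:E)%E).
    by apply: lee_sum => j _; exact: FE.
  rewrite sumEFin sumr_const card_ord lee_fin -[leLHS]mulr_natl.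
  (* There are at most [2 ^ (n + 2)] balls, each with bound [4 ^ (-(n + 2))]. *)
  apply: (@le_trans _ _ (2 ^+ n.+2 * 2^-1 ^+ (n.+2 + n.+2))).
    apply: ler_wpM2r; first by rewrite ltW// half_pow_gt0.
    rewrite -natrX ler_nat (expnS 2 n.+1) mul2n -addnn.
    by rewrite -addn1 leq_add2l expn_gt0.
  rewrite exprD mulrA -exprMn divff ?gt_eqF// expr1n !mul1r.
  by apply: half_pow_le; exact: leqW.
apply: filterS (eventually_notin_of_geometric _ _ _ mu D 1 N mD D_le) => x [N' hN'] Lx.
apply: (@eventually_at_scales _ _ (maxn N N').+2) => -[//|[//|n]] r.
(* Here [2 ^ (-(n + 3)) <= r < 2 ^ (-(n + 2))], so [2 ^ (-n) <= 8 * r] and [l n <= ell r]. *)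
rewrite !ltnS geq_max => /andP[Nn N'n] nr rn.
have [rn0 ln em me lm] := facts n Nn.
have hp j : 2^-1 ^+ j.+1 = 2^-1 ^+ j / 2 :> R by rewrite exprSr.
have r_gt0 : 0 < r by apply: lt_le_trans nr; exact: half_pow_gt0.
apply: (@le_trans _ _ (tau (2^-1 ^+ n) x)).
  by apply: cover_time_le; rewrite !hp in nr; lra.
apply: (@le_trans _ _ (T n)%:R%:E).
  apply: cover_time_le_nat => y Ly.
  have [j jJ jy] := cell_point_close x0 n.+1 y Ly.
  have : exists2 t, (t < T n)%N & ball (cell_point x0 n.+1 j) (2^-1 ^+ n.+1) (iter t f x).
    apply: contrapT => h; apply: (hN' n N'n).
    rewrite /D -(bigcup_mkord _ (fun j => missing_orbits R A P X f (T n)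
      (cell_point x0 n.+1 j) (2^-1 ^+ n.+1))).
    exists j => //; split=> // t tT jt; apply: h; by exists t.
  move=> [t tT jt]; exists t; first exact: ltnW.
  move: jt jy; rewrite -ball_normE /= hp => jt jy.
  rewrite (_ : iter t f x - y = (cell_point x0 n.+1 j - y) -
    (cell_point x0 n.+1 j - iter t f x)); last by ring.
  by apply: le_lt_trans (ler_normB _ _) _; lra.
have lr : l n <= ell r.
  by apply: (ell_le R mu r0 ell M_ell) => //; exact: ltW.
rewrite lee_fin; apply: (@le_trans _ _ (expR (8 * l n))); last by rewrite ler_expR ler_pM2l.
apply: (@le_trans _ _ ((m n)%:R ^+ 4)); last first.
  have -> : expR (8 * l n) = expR (2 * l n) ^+ 4.
    by rewrite -expRM_natl; congr expR; ring.
  by apply: lerXn2r => //; rewrite nnegrE ?expR_ge0.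
rewrite -natrX ler_nat /T.
have : (3 <= m n)%N.
  rewrite -(ler_nat R); have : (1 : R) <= n.+2%:R by rewrite ler1n.
  by lra.
exact: block_count_le.
Qed.

End UpperBound.

(** * Passage to iterated logarithms and stretched dimensions *)

Theorem theorem1p4 (R : realType) (A : pointedType)
  (P : A -> set R) (X : set R) (f : R -> R)
  (mu : probability (measurableTypeR R) R)
  (A_countable : countable [set: A])
  (f_markov : piecewise_expanding_markov P X f)
  (f_transitive : topologically_transitive P f)
  (mu_repeller : mu (repeller P X f) = 1%E)
  (mu_invariant : invariant_measure P X f mu)
  (mu_ergodic : ergodic_measure P X f mu)
  (dim_infinite : upper_minkowski_dim mu = +oo%E)
  (lower_dim_gt0 : (0 < lower_stretched_minkowski_dim mu)%E)
  (upper_dim_lty : (upper_stretched_minkowski_dim mu < +oo)%E) :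
  {ae mu, forall x, repeller P X f x ->
    (lower_stretched_minkowski_dim mu
       <= limf_einf (loglog_cover_rate P X f x) (0 : R)^'+)%E /\
    (upper_stretched_minkowski_dim mu
       <= limf_esup (loglog_cover_rate P X f x) (0 : R)^'+)%E} /\
  (exponentially_psi_mixing P f mu ->
   {ae mu, forall x, repeller P X f x ->
     limf_einf (loglog_cover_rate P X f x) (0 : R)^'+
       = lower_stretched_minkowski_dim mu /\
     limf_esup (loglog_cover_rate P X f x) (0 : R)^'+
       = upper_stretched_minkowski_dim mu}).
Proof.
have [r0 [s [ell [r0_gt0 _ s0 h]]]] := min_ball_measure_exp _ mu lower_dim_gt0 upper_dim_lty.
have ell_ge r : 0 < r -> r < r0 -> expR (s * - ln r) <= ell r by move=> rp /(h r rp)[].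
have M_ell r : 0 < r -> r < r0 -> min_ball_measure mu r = (expR (- ell r))%:E.
  by move=> rp /(h r rp)[].
have ell0 := ell_gt0 R r0 s ell ell_ge.
have ae_filter : Filter (almost_everywhere mu) := ae_filter_ringOfSetsType mu.
have lower : {ae mu, forall x, repeller P X f x ->
    (lower_stretched_minkowski_dim mu
       <= limf_einf (loglog_cover_rate P X f x) (0 : R)^'+)%E /\
    (upper_stretched_minkowski_dim mu
       <= limf_esup (loglog_cover_rate P X f x) (0 : R)^'+)%E}.
  have := cover_time_ge_ae R A P X f mu f_markov A_countable mu_repeller mu_invariant
    r0 s ell r0_gt0 s0 ell_ge M_ell.
  apply: filterS => x hx Lx; have /near_right0P[e e0 he] := hx Lx.
  (* The dilation [4] is that of the cover time bound; [ln 2] pays for the halved exponent. *)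
  apply: (@log_ratio_dilate_le _ (fun r => lne (lne (cover_time P X f r x)))
    (fun r => lne `|lne (min_ball_measure mu r)|%E) 4 (ln 2)) => //.
  apply/near_right0P; exists (Num.min e (r0 / 4)); first by rewrite lt_min e0 divr_gt0.
  move=> r rp; rewrite lt_min => /andP[re rr].
  have r4p : 0 < 4 * r by rewrite mulr_gt0.
  have r4 : 4 * r < r0 by rewrite mulrC -ltr_pdivlMr.
  rewrite M_ell// lne_abse_lne_expRN ?ell0//.
  apply: (@le_trans _ _ ((ln (ell (4 * r) / 2))%:E + (ln 2)%:E)%E).
    by rewrite -EFinD lee_fin -lnM ?posrE ?divr_gt0 ?ell0// divfK.
  rewrite leeD2r// -lne_lne_expR ?divr_gt0 ?ell0//.
  by do 2!apply: lne_le; exact: he.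
split=> // -[nu mu_nu [C1 [rho [psi [_ rho0 _ psi_decay psi_mixing]]]]].
have [gamma g1 itin] := branch_itinerary_close R A P X f f_markov.
have upper := cover_time_le_ae R A P X f mu f_markov A_countable mu_repeller
  r0 s ell r0_gt0 s0 ell_ge M_ell nu mu_nu C1 rho gamma psi rho0 psi_decay psi_mixing g1 itin.
apply: filterS2 lower upper => x lo up Lx.
have [lo1 lo2] := lo Lx; have /near_right0P[e e0 he] := up Lx.
have [up1 up2] : (limf_einf (loglog_cover_rate P X f x) (0 : R)^'+
       <= lower_stretched_minkowski_dim mu)%E /\
    (limf_esup (loglog_cover_rate P X f x) (0 : R)^'+
       <= upper_stretched_minkowski_dim mu)%E.
  (* The same comparison with the roles exchanged: the cover time is taken at scale [8 * r], and
     [ln 8] comes from the factor [8] in its exponent. *)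
  apply: (@log_ratio_dilate_le _ (fun r => lne `|lne (min_ball_measure mu r)|%E)
    (fun r => lne (lne (cover_time P X f r x))) 8 (ln 8)) => //.
  apply/near_right0P; exists (Num.min e r0); first by rewrite lt_min e0.
  move=> r rp; rewrite lt_min => /andP[re rr].
  rewrite M_ell// lne_abse_lne_expRN ?ell0//.
  rewrite -EFinD -lnM ?posrE ?ell0// (mulrC (ell r)) -lne_lne_expR ?mulr_gt0 ?ell0//.
  by do 2!apply: lne_le; exact: he.
by split; apply/eqP; rewrite eq_le ?lo1 ?lo2 ?up1 ?up2.
Qed.
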